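(* Let $a_1,a_2,\dots$ be i.i.d. random variables satisfying $\mathbb{E}[|a_1|]<\infty$. Let $\{z_n\}_{n\ge1}$ be a sequence of complex numbers satisfying the condition that for Lebesgue a.e. $z\in\mathbb{C}$ there exists a compact set $K_z\subset\mathbb{C}$ with $d(z,K_z)>0$ such that there are infinitely many $z_k$'s in $K_z$, and there is a point $\omega\in\mathbb{C}$ that is not a limit point of the $z_n$'s. Define $$L_n(z):=\frac{a_1}{z-z_1}+\frac{a_2}{z-z_2}+\cdots+\frac{a_n}{z-z_n}.$$ Then $\frac1n\Delta\log|L_n(z)|\to0$ in probability, in the sense of distributions, as $n\to\infty$.
   Context: The random variables $a_k$ are complex-valued and the sequence $\{z_n\}$ is deterministic. $\Delta$ is the Laplacian on $\mathbb{C}$, $m$ is Lebesgue measure on $\mathbb{C}$, and $d(z,K)$ is the Euclidean distance from $z$ to $K$. A point $\omega$ is a limit point of the sequence $\{z_n\}$ if every neighbourhood of $\omega$ contains $z_n$ for infinitely many $n$. Convergence in probability in the sense of distributions means that for every $f\in C_c^\infty(\mathbb{C})$, $\int_{\mathbb{C}}\frac1n\log|L_n(z)|\,\Delta f(z)\,dm(z)\to0$ in probability.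
   Formalization: The random variables a_k are additionally assumed not to be almost surely constant; for a_k = 1 and a van der Corput sequence z_n on the unit circle the claim as stated fails, and for a_k = 0 log|L_n| is undefined. *)

(* Defs.v *)
From HB Require Import structures.
From mathcomp Require Import all_boot all_order all_algebra.
From mathcomp Require Import all_classical all_reals all_analysis.
From mathcomp Require Import complex.

Set Implicit Arguments.
Unset Strict Implicit.
Unset Printing Implicit Defensive.

Import Order.TTheory GRing.Theory Num.Theory.
Import numFieldNormedType.Exports.

Local Open Scope classical_set_scope.
Local Open Scope ring_scope.
Local Open Scope complex_scope.

(* The algebra of the complex numbers takes place in R[i], their metric
   topology is the one of R[i]^o, and measurability, Lebesgue measure and
   real differentiation are those of the plane R * R, identified with R[i]
   by [cplx]. *)
Section Plane.
Variable R : realType.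

Definition cplx (p : R * R) : R[i] := p.1 +i* p.2.

Definition abs (w : R[i]) : R := ComplexField.Normc.normc w.

Definition lebesgueC : {measure set (measurableTypeR R * measurableTypeR R) -> \bar R} :=
  (@lebesgue_measure R \x @lebesgue_measure R)%E.

(* infimum of the Euclidean distances; only meaningful for K nonempty *)
Definition dist (w : R[i]) (K : set R[i]) : R :=
  inf [set abs (w - v) | v in K].

(* Indices are counted, not values: a constant sequence has a limit point. *)
Definition seq_limit_point (z : nat -> R[i]) (w : R[i]) : Prop :=
  forall U : set R[i]^o, nbhs (w : R[i]^o) U -> infinite_set [set k | U (z k)].

Definition dir (b : bool) : R * R := if b then (0, 1) else (1, 0).

Definition partial (b : bool) (f : R * R -> R) : R * R -> R := 'D_(dir b) f.

Definition smooth (f : R * R -> R) : Prop :=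
  forall s : seq bool, let g := foldr partial f s in
    continuous g /\ forall (b : bool) (p : R * R), derivable g p (dir b).

Definition test_function (f : R * R -> R) : Prop :=
  smooth f /\ compact (closure [set p | f p != 0]).

Definition laplacian (f : R * R -> R) (p : R * R) : R :=
  partial false (partial false f) p + partial true (partial true f) p.

(* The sequences are indexed from 0, so a 0 and z 0 stand for the first
   terms; a term with w = z k is 0, as x / 0 = 0. *)
Definition L (a z : nat -> R[i]) (n : nat) (w : R[i]) : R[i] :=
  \sum_(k < n) a k / (w - z k).

(* <(1/n) Delta log|L_n|, f>.  Since ln 0 = 0, this is 0 if L_n vanishes
   identically; otherwise the zeros and poles of L_n form a null set. *)
Definition log_potential_pairing (a z : nat -> R[i]) (n : nat)
    (f : R * R -> R) : R :=
  \int[lebesgueC]_p (n%:R^-1 * ln (abs (L a z n (cplx p))) * laplacian f p).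

End Plane.

Section Probability.
Context (R : realType) (d : measure_display) (T : measurableType d).
Variable P : probability T R.

Definition mutually_independent (d' : measure_display)
    (S : measurableType d') (X : nat -> {RV P >-> S}) : Prop :=
  forall (s : seq nat) (B : nat -> set S), uniq s ->
    (forall k, measurable (B k)) ->
    P (\big[setI/setT]_(k <- s) (X k @^-1` B k)) =
    (\prod_(k <- s) P (X k @^-1` B k))%E.

Definition identically_distributed (d' : measure_display)
    (S : measurableType d') (X : nat -> {RV P >-> S}) : Prop :=
  forall (k : nat) (B : set S), measurable B ->
    distribution P (X k) B = distribution P (X 0%N) B.

(* Almost sure constancy has to be excluded for the coefficients a k: with
   a k = 1 and z the dyadic van der Corput sequence on the unit circle,
   L_n(w) = n w^(n-1) / (w^n - 1) for n = 2^m, and (1/n) log|L_n(w)| tends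
   to log|w| on the unit disc. *)
Definition degenerate (d' : measure_display) (S : measurableType d')
    (X : {RV P >-> S}) : Prop :=
  exists c : S, {ae P, forall t, X t = c}.

Definition cvg_in_probability (X : nat -> T -> R) (l : R) : Prop :=
  forall e : R, 0 < e -> P [set t | e < `|X n t - l|] @[n --> \oo] --> 0%E.

End Probability.

(* Main.v *)
(* Write u_n = (1/n) log|L_n| and let D be a box containing the support of f;
   it is enough that the integral of |u_n| over D tends to 0 in probability.

   For a.e. p the numbers 1/(p - z_k) cluster at some beta <> 0, so L_n(p)
   contains arbitrarily many independent non-degenerate summands of comparable
   size, and P(|L_n(p)| < delta) tends to 0 for some delta > 0.  In particular
   u_n(p)^- tends to 0 in probability, and by Fubini and dominated convergence
   the area of {p in D : u_n(p) < -eps} tends to 0 in probability.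

   It remains to see that no mass of |u_n| concentrates on small sets.  For the
   positive part this follows from ln x <= ln h + x/h and the bound of |L_n| by
   the sum of the |a_k| / |p - z_k|, as 1/|p - zeta| has an integral over D that
   is bounded uniformly in zeta.  For the negative part, choose a generic point
   w near the point which is not a limit point of z, hence at distance >= d0
   from all z_k; with probability tending to 1, |L_n(w)| >= exp(-n).  Splitting
   numerator and denominator of L_n into linear factors gives, with
   C >= |p - w| and zeta_j the zeros of the numerator,
     |L_n(w)| <= |L_n(p)| prod_j (1 + C / |p - zeta_j|) (1 + C / d0)^n,
   and the logarithm of the product is again controlled by the 1/|p - zeta_j|. *)

Require Import Defs.
From HB Require Import structures.
From mathcomp Require Import all_boot all_order all_algebra.
From mathcomp Require Import all_classical all_reals all_analysis.
From mathcomp Require Import measurable_realfun complex ring lra.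

Set Implicit Arguments.
Unset Strict Implicit.
Unset Printing Implicit Defensive.

Import Order.TTheory GRing.Theory Num.Theory.
Import numFieldNormedType.Exports.

Local Open Scope classical_set_scope.
Local Open Scope ring_scope.

Local Notation re := complex.Re.
Local Notation im := complex.Im.

(** * The modulus of a complex number and its coordinates *)

Section ComplexModulus.
Variable R : realType.
Implicit Types v w : R[i].

Lemma abs_ge0 w : 0 <= abs w.
Proof. by case: w => x y; exact: sqrtr_ge0. Qed.

Lemma abs0 : abs (0 : R[i]) = 0.
Proof. exact: ComplexField.Normc.normc0. Qed.

Lemma abs_eq0 w : (abs w == 0) = (w == 0).
Proof.
apply/eqP/eqP => [|->]; last exact: abs0.
exact: ComplexField.Normc.eq0_normc.
Qed.

Lemma abs_gt0 w : (0 < abs w) = (w != 0).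
Proof. by rewrite lt_neqAle abs_ge0 andbT eq_sym abs_eq0. Qed.

Lemma absM v w : abs (v * w) = abs v * abs w.
Proof. exact: ComplexField.Normc.normcM. Qed.

Lemma absV w : abs w^-1 = (abs w)^-1.
Proof. exact: ComplexField.Normc.normcV. Qed.

Lemma absD v w : abs (v + w) <= abs v + abs w.
Proof. exact: le_normcD. Qed.

Lemma absN w : abs (- w) = abs w.
Proof. exact: normcN. Qed.

Lemma absMn w (n : nat) : abs (w *+ n) = abs w *+ n.
Proof. exact: normcMn. Qed.

Lemma absB v w : abs (v - w) = abs (w - v).
Proof. by rewrite -absN opprB. Qed.

Lemma abs_sum (I : Type) (r : seq I) (F : I -> R[i]) :
  abs (\sum_(i <- r) F i) <= \sum_(i <- r) abs (F i).
Proof.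
elim/big_ind2 : _ => // [|x1 x2 y1 y2 h1 h2]; first by rewrite abs0.
exact: le_trans (absD _ _) (lerD h1 h2).
Qed.

Lemma abs_prod (I : Type) (r : seq I) (F : I -> R[i]) :
  abs (\prod_(i <- r) F i) = \prod_(i <- r) abs (F i).
Proof.
elim/big_ind2 : _ => // [|x1 x2 y1 y2 <- <-]; last exact: absM.
exact: ComplexField.Normc.normc1.
Qed.

Lemma normr_Re_le_abs w : `|re w| <= abs w.
Proof.
case: w => x y /=; rewrite -sqrtr_sqr ler_sqrt ?lerDl ?sqr_ge0//.
by rewrite addr_ge0// sqr_ge0.
Qed.

Lemma normr_Im_le_abs w : `|im w| <= abs w.
Proof.
case: w => x y /=; rewrite -sqrtr_sqr ler_sqrt ?lerDr ?sqr_ge0//.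
by rewrite addr_ge0// sqr_ge0.
Qed.

Lemma abs_le_ReIm w : abs w <= `|re w| + `|im w|.
Proof.
case: w => x y /=; rewrite -[leRHS]ger0_norm ?addr_ge0// -sqrtr_sqr.
rewrite ler_sqrt ?sqr_ge0// sqrrD !real_normK ?num_real// -addrA lerD2l lerDr.
by rewrite mulrn_wge0// mulr_ge0.
Qed.

Lemma normr_abs w : `|w| = (abs w)%:C%C.
Proof. by case: w. Qed.

End ComplexModulus.

(** * Measurability of complex-valued functions, read off the coordinates *)

Section ComplexMeasurability.
Context (R : realType) (d : measure_display) (T : measurableType d).

Definition cmeasurable (g : T -> R[i]) :=
  measurable_fun setT (@re R \o g) /\ measurable_fun setT (@im R \o g).

Lemma measurable_funV (f : T -> R) :
  measurable_fun setT f -> measurable_fun setT (fun x => (f x)^-1).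
Proof.
move=> mf.
(* [x^-1 = x * (x^2)^-1], and on nonnegative reals the inverse is a power. *)
have -> : (fun x => (f x)^-1) = (fun x => f x * (f x ^+ 2) `^ (-1)).
  apply/funext => x; rewrite powR_inv1 ?sqr_ge0//.
  have [->|f0] := eqVneq (f x) 0; first by rewrite invr0 mul0r.
  by rewrite expr2 invfM mulrA divff// mul1r.
apply: measurable_funM => //.
exact: (measurableT_comp (measurable_powR (-1)) (measurable_funX 2 mf)).
Qed.

Lemma cmeasurable_cst w : cmeasurable (cst w).
Proof. by split; exact: measurable_cst. Qed.

Lemma cmeasurableD f g :
  cmeasurable f -> cmeasurable g -> cmeasurable (fun x => f x + g x).
Proof.
move=> [f1 f2] [g1 g2]; split.
  rewrite (_ : _ \o _ = (@re R \o f) \+ (@re R \o g)).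
    exact: measurable_funD.
  by apply/funext => x /=; case: (f x) => ? ?; case: (g x).
rewrite (_ : _ \o _ = (@im R \o f) \+ (@im R \o g)).
  exact: measurable_funD.
by apply/funext => x /=; case: (f x) => ? ?; case: (g x).
Qed.

Lemma cmeasurableM f g :
  cmeasurable f -> cmeasurable g -> cmeasurable (fun x => f x * g x).
Proof.
move=> [f1 f2] [g1 g2]; split.
  rewrite (_ : _ \o _ = (fun x => re (f x) * re (g x) - im (f x) * im (g x))).
    by apply: measurable_funB; exact: measurable_funM.
  by apply/funext => x /=; case: (f x) => ? ?; case: (g x).
rewrite (_ : _ \o _ = (fun x => re (f x) * im (g x) + im (f x) * re (g x))).
  by apply: measurable_funD; exact: measurable_funM.
by apply/funext => x /=; case: (f x) => ? ?; case: (g x).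
Qed.

Lemma cmeasurableV f : cmeasurable f -> cmeasurable (fun x => (f x)^-1).
Proof.
move=> [f1 f2].
have mN : measurable_fun setT (fun x => (re (f x) ^+ 2 + im (f x) ^+ 2)^-1).
  by apply: measurable_funV; apply: measurable_funD; exact: measurable_funX.
split.
  rewrite (_ : _ \o _ =
      (fun x => re (f x) * (re (f x) ^+ 2 + im (f x) ^+ 2)^-1)).
    exact: measurable_funM.
  by apply/funext => x /=; case: (f x).
rewrite (_ : _ \o _ =
    (fun x => - (im (f x) * (re (f x) ^+ 2 + im (f x) ^+ 2)^-1))).
  by apply: measurable_funN; exact: measurable_funM.
by apply/funext => x /=; case: (f x).
Qed.

Lemma cmeasurable_sum (I : Type) (r : seq I) (F : I -> T -> R[i]) :
  (forall i, cmeasurable (F i)) -> cmeasurable (fun x => \sum_(i <- r) F i x).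
Proof.
move=> mF; elim: r => [|i r ih].
  rewrite (_ : (fun x => _) = cst 0); first exact: cmeasurable_cst.
  by apply/funext => x; rewrite big_nil.
rewrite (_ : (fun x => _) = (fun x => F i x + \sum_(j <- r) F j x)).
  exact: cmeasurableD.
by apply/funext => x; rewrite big_cons.
Qed.

Lemma cmeasurable_cplx (g : T -> R * R) :
  measurable_fun setT g -> cmeasurable (@cplx R \o g).
Proof. by move=> mg; split; apply: measurableT_comp => //. Qed.

Lemma measurable_abs f :
  cmeasurable f -> measurable_fun setT (fun x => abs (f x)).
Proof.
move=> [f1 f2].
rewrite (_ : (fun x => _) =
  (fun x => (re (f x) ^+ 2 + im (f x) ^+ 2) `^ (2^-1))).
  apply: (measurableT_comp (measurable_powR (2^-1))).
  by apply: measurable_funD; exact: measurable_funX.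
apply/funext => x; case: (f x) => a b /=.
by rewrite powR12_sqrt// addr_ge0// sqr_ge0.
Qed.

End ComplexMeasurability.

(** Coefficients and evaluation point may both depend on [t], so that one statement covers a fixed
    point, fixed coefficients, and joint measurability. *)
Lemma measurable_L (R : realType) (d : measure_display) (T : measurableType d)
    (a : nat -> T -> R * R) (z : nat -> R[i]) (g : T -> R * R) (n : nat) :
  (forall k, measurable_fun setT (a k)) -> measurable_fun setT g ->
  cmeasurable (fun t => L (fun k => cplx (a k t)) z n (cplx (g t))).
Proof.
move=> ma mg; apply: cmeasurable_sum => k; apply: cmeasurableM.
  exact: cmeasurable_cplx.
apply: cmeasurableV; apply: cmeasurableD; first exact: cmeasurable_cplx.
exact: cmeasurable_cst.
Qed.

(** * Laws of weighted sums of independent variables *)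

Section IndependentSums.
Context (R : realType) (d : measure_display) (T : measurableType d).
Context (P : probability T R) (a : nat -> {RV P >-> (R * R)%type}).
Implicit Types (b : nat -> R[i]) (s u : seq nat).

Definition plane_of (w : R[i]) : R * R := (re w, im w).

Lemma plane_ofK w : cplx (plane_of w) = w.
Proof. by case: w. Qed.

Definition wsum b s (t : T) : R[i] := \sum_(k <- s) cplx (a k t) * b k.

(** The sum moved to the plane, where it is a random variable with a distribution. With [b k] equal
    to 1 / (w - z_k) and [s] the first [n] indices it is L_n(w). *)
Definition psum b s (t : T) : R * R := plane_of (wsum b s t).

Lemma cmeasurable_wsum b s : cmeasurable (wsum b s).
Proof.
apply: cmeasurable_sum => k; apply: cmeasurableM; last exact: cmeasurable_cst.
exact: cmeasurable_cplx.
Qed.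

Lemma measurable_psum b s : measurable_fun setT (psum b s).
Proof. by have [h1 h2] := cmeasurable_wsum b s; exact: measurable_fun_pair. Qed.

HB.instance Definition _ b s :=
  isMeasurableFun.Build _ _ _ _ (psum b s) (measurable_psum b s).

Definition event u (B : nat -> set (R * R)) : set T :=
  \big[setI/setT]_(k <- u) (a k @^-1` B k).

Lemma measurable_event u B :
  (forall k, measurable (B k)) -> measurable (event u B).
Proof.
by move=> mB; apply: bigsetI_measurable => k _; exact: measurable_funPTI.
Qed.

Definition step (c : R[i]) (q : (R * R) * (R * R)) : R * R :=
  plane_of (cplx q.1 * c + cplx q.2).

Lemma measurable_step c : measurable_fun setT (step c).
Proof.
suff [h1 h2] : cmeasurable (fun q : (R * R) * (R * R) => cplx q.1 * c + cplx q.2).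
  exact: measurable_fun_pair.
apply: cmeasurableD.
  by apply: cmeasurableM; [exact: cmeasurable_cplx|exact: cmeasurable_cst].
exact: cmeasurable_cplx.
Qed.

Lemma psum_cons b k s t : psum b (k :: s) t = step (b k) (a k t, psum b s t).
Proof. by rewrite /psum /step /wsum big_cons /= plane_ofK. Qed.

Hypothesis a_indep : mutually_independent a.

Local Open Scope ereal_scope.

Lemma P_event u B : uniq u -> (forall k, measurable (B k)) ->
  P (event u B) = \prod_(k <- u) P (a k @^-1` B k).
Proof. exact: a_indep. Qed.

(** The event constrains single variables with indices outside [s]; this lets an induction on [s]
    hand the constraint on a new index over to the event. *)
Definition sums_indep b s := forall u B A, uniq (s ++ u) ->
  (forall k, measurable (B k)) -> measurable A ->
  P ((psum b s @^-1` A) `&` event u B) = P (psum b s @^-1` A) * P (event u B).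

(** On rectangles the constraint on [a k] can be counted as part of the event, so [sums_indep] gives
    the product; rectangles determine a product measure, which settles general [X]. *)
Lemma joint_law b k s u B X : sums_indep b s -> uniq (k :: s ++ u) ->
  (forall k, measurable (B k)) -> measurable X ->
  P (((fun t => (a k t, psum b s t)) @^-1` X) `&` event u B) =
  P (event u B) *
    (distribution P (a k) \x distribution P (psum b s)) X.
Proof.
move=> sP uku mB mX.
have mE : measurable (event u B) by exact: measurable_event.
have mpair : measurable_fun setT (fun t => (a k t, psum b s t)).
  by apply: measurable_fun_pair => //; exact: measurable_psum.
have mprX : measurable ((fun t => (a k t, psum b s t)) @^-1` X).
  by rewrite -[X in measurable X]setTI; exact: mpair.
(* The normalisation below divides by the probability of the event; for a null event both sides are
   0. *)
have [PE0|PEn0] := eqVneq (P (event u B)) 0.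
  rewrite PE0 mul0e; apply/eqP; rewrite eq_le measure_ge0 andbT -PE0.
  by apply: le_measure => //; rewrite ?inE//; exact: measurableI.
have PEfin : P (event u B) \is a fin_num by exact: fin_num_measure.
have r0 : (0 <= (fine (P (event u B)))^-1)%R by rewrite invr_ge0 fine_ge0.
pose m' := mscale (NngNum r0)
  (measure_function_pushforward__canonical__measure_function_Measure
    (mrestr P mE) mpair).
have rP : (fine (P (event u B)))^-1%:E * P (event u B) = 1.
  rewrite -[X in _ * X](fineK PEfin) -EFinM mulVf//.
  by rewrite fine_eq0.
rewrite (@product_measure_unique _ _ _ _ _ (distribution P (a k))
  (distribution P (psum b s)) m') //; last first.
  move=> A A' mA mA'; rewrite /m' /mscale /= /pushforward /mrestr /=.
  (* [B'] adds the condition on [a k]; since [k] is not in [u], the other conditions are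
     unchanged. *)
  pose B' j := if j == k then A else B j.
  have mB' j : measurable (B' j) by rewrite /B'; case: ifP.
  transitivity ((fine (P (event u B)))^-1%:E *
      P (psum b s @^-1` A' `&` event (k :: u) B')).
    congr (_ * P _); rewrite (_ : _ @^-1` _ = a k @^-1` A `&` psum b s @^-1` A')//.
    rewrite /event big_cons {1}/B' eqxx setIA [_ `&` (a k @^-1` A)]setIC.
    congr (_ `&` _); apply: eq_big_seq => j ju; rewrite /B'.
    case: eqP ju => // -> ku; move: uku => /= /andP[].
    by rewrite mem_cat ku orbT.
  have uku' : uniq (k :: u).
    by move: uku => /=; rewrite mem_cat cat_uniq negb_or; case/andP => /andP[_ ->] /and3P[].
  rewrite sP//; last first.
    move: uku => /=; rewrite mem_cat negb_or !cat_uniq /= negb_or.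
    by case/andP => /andP[-> ->] /and3P[-> -> ->].
  have -> : P (event (k :: u) B') = P (a k @^-1` A) * P (event u B).
    rewrite P_event// big_cons {1}/B' eqxx P_event//; last by case/andP: uku'.
    congr (_ * _); apply: eq_big_seq => j ju; rewrite /B'.
    by case: eqP ju => // -> ku; move: uku' => /=; rewrite ku.
  by rewrite !muleA [_ * P (event u B)]muleC !muleA [P (event u B) * _]muleC rP mul1e muleC.
rewrite /m' /mscale /= /pushforward /mrestr /= muleA [X in X * _]muleC rP.
by rewrite mul1e.
Qed.

(** In the induction the new sum is the image under [step] of the pair treated in [joint_law]; that
    law is used once with the given event and once without constraints. *)
Lemma sums_indepP b s : uniq s -> sums_indep b s.
Proof.
elim: s => [_|k s ih /= /andP[ks us]] u B A.
  move=> uu mB mA.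
  have -> : psum b [::] = cst (plane_of 0%R).
    by apply/funext => t; rewrite /psum /wsum big_nil.
  have [p0|p0] := pselect (A (plane_of 0%R)).
    have -> : cst (plane_of 0%R) @^-1` A = [set: T] by apply/seteqP; split.
    by rewrite setTI probability_setT mul1e.
  have -> : cst (plane_of 0%R) @^-1` A = set0 :> set T by apply/seteqP; split.
  by rewrite set0I measure0 mul0e.
move=> uku mB mA.
have mstepA : measurable (step (b k) @^-1` A).
  by rewrite -[X in measurable X]setTI; exact: measurable_step.
have -> : psum b (k :: s) @^-1` A =
    (fun t => (a k t, psum b s t)) @^-1` (step (b k) @^-1` A).
  by apply/seteqP; split => t /=; rewrite psum_cons.
rewrite joint_law//; last exact: ih.
have := @joint_law b k s [::] B _ (ih us) _ mB mstepA.
rewrite /event big_nil setIT probability_setT mul1e => ->; first exact: muleC.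
by rewrite cats0 /= ks.
Qed.

(** Conditioning on the new summand: a product measure integrates the measures of the sections. *)
Lemma psum_cons_law b k s A : uniq (k :: s) -> measurable A ->
  P (psum b (k :: s) @^-1` A) =
  \int[distribution P (a k)]_y P (psum b s @^-1` [set x | A (step (b k) (y, x))]).
Proof.
move=> uks mA.
have mstepA : measurable (step (b k) @^-1` A).
  by rewrite -[X in measurable X]setTI; exact: measurable_step.
have us : uniq s by case/andP: uks.
have := @joint_law b k s [::] (fun=> setT) _ (@sums_indepP b s us) _ _ mstepA.
rewrite /event big_nil setIT probability_setT mul1e => H.
have -> : psum b (k :: s) @^-1` A =
    (fun t => (a k t, psum b s t)) @^-1` (step (b k) @^-1` A).
  by apply/seteqP; split => t /=; rewrite psum_cons.
rewrite H//; last by rewrite cats0.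
apply: eq_integral => y _ /=; rewrite /pushforward; congr (P _).
by apply/seteqP; split => t /=; rewrite xsectionE.
Qed.

End IndependentSums.

(** * Concentration of the sums on squares *)

Section Concentration.
Context (R : realType) (d : measure_display) (T : measurableType d).
Context (P : probability T R) (a : nat -> {RV P >-> (R * R)%type}).
Implicit Types (b : nat -> R[i]) (s u : seq nat) (w : R[i]) (r : R).

(** Closed squares replace discs: as products of intervals they have an explicit area, and they lie
    between the discs of radii [r] and [2 r]. *)
Definition sqbox w r : set (R * R) :=
  [set x | `|re (cplx x - w)| <= r /\ `|im (cplx x - w)| <= r].

Lemma measurable_sqbox w r : measurable (sqbox w r).
Proof.
have [h1 h2] : cmeasurable (fun x : R * R => cplx x - w).
  apply: cmeasurableD; last exact: cmeasurable_cst.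
  exact: (cmeasurable_cplx (@measurable_id _ _ _)).
apply: measurableI.
  have := measurable_fun_ler (measurableT_comp (@normr_measurable R setT) h1)
    (measurable_cst r).
  by move=> /(_ measurableT [set true] I); rewrite setTI.
have := measurable_fun_ler (measurableT_comp (@normr_measurable R setT) h2)
  (measurable_cst r).
by move=> /(_ measurableT [set true] I); rewrite setTI.
Qed.

Lemma sqbox_abs x w r : sqbox w r x -> abs (cplx x - w) <= r *+ 2.
Proof.
by move=> [h1 h2]; rewrite (le_trans (abs_le_ReIm _))// mulr2n lerD.
Qed.

Lemma abs_sqbox x w r : abs (cplx x - w) <= r -> sqbox w r x.
Proof.
move=> h; split; first exact: le_trans (normr_Re_le_abs _) h.
exact: le_trans (normr_Im_le_abs _) h.
Qed.

(** The supremum over [w] is the Levy concentration function of the sum, taken with squares. *)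
Definition mass b s w r : R := fine (P (psum a b s @^-1` sqbox w r)).

Lemma measurable_psum_sqbox b s w r : measurable (psum a b s @^-1` sqbox w r).
Proof.
by rewrite -[X in measurable X]setTI; apply: measurable_psum => //; exact: measurable_sqbox.
Qed.

Lemma massE b s w r : (mass b s w r)%:E = P (psum a b s @^-1` sqbox w r).
Proof. by rewrite fineK// fin_num_measure//; exact: measurable_psum_sqbox. Qed.

Lemma mass_ge0 b s w r : 0 <= mass b s w r.
Proof. exact: fine_ge0. Qed.

Lemma mass_le1 b s w r : mass b s w r <= 1.
Proof.
by rewrite -lee_fin massE probability_le1//; exact: measurable_psum_sqbox.
Qed.

Lemma mass_perm b s s' w r : perm_eq s s' -> mass b s w r = mass b s' w r.
Proof.
move=> ss'; rewrite /mass (_ : psum a b s = psum a b s')//.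
by apply/funext => t; rewrite /psum /wsum (perm_big _ ss').
Qed.

Lemma step_sqbox c w r y :
  [set x | sqbox w r (step c (y, x))] = sqbox (w - cplx y * c) r.
Proof.
rewrite /sqbox; apply/funext => x; rewrite /mkset /step plane_ofK.
by rewrite (_ : cplx y * c + cplx x - w = cplx x - (w - cplx y * c)) //; ring.
Qed.

Lemma measurable_mass b s c w r :
  measurable_fun setT (fun y : R * R => mass b s (w - cplx y * c) r).
Proof.
apply/measurable_EFinP.
have mX : measurable (step c @^-1` sqbox w r).
  rewrite -[X in measurable X]setTI; apply: measurable_step => //.
  exact: measurable_sqbox.
have := measurable_fun_xsection (distribution P (psum a b s)) mX.
apply: eq_measurable_fun => y _.
have xE : xsection (step c @^-1` sqbox w r) y = sqbox (w - cplx y * c) r.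
  by rewrite -step_sqbox; apply/funext => x; rewrite /xsection /= inE.
rewrite [LHS]/= xE /distribution /pushforward [RHS]/= massE.
by [].
Qed.

Hypothesis a_indep : mutually_independent a.
Hypothesis a_ident : identically_distributed a.

Let mu := distribution P (a 0%N).

Lemma mass_cons b k s w r : uniq (k :: s) ->
  (mass b (k :: s) w r)%:E = (\int[mu]_y (mass b s (w - cplx y * b k) r)%:E)%E.
Proof.
move=> uks; rewrite massE psum_cons_law//; last exact: measurable_sqbox.
rewrite (eq_measure_integral mu)//; last by move=> A mA _; exact: a_ident.
by apply: eq_integral => y _; rewrite massE step_sqbox.
Qed.

(** By [mass_cons] the new mass is an average of masses of the shorter sum, so an independent
    summand never raises the concentration. *)
Lemma mass_cons_le b k s r M : uniq (k :: s) ->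
  (forall w, mass b s w r <= M) -> forall w, mass b (k :: s) w r <= M.
Proof.
move=> uks hM w; rewrite -lee_fin mass_cons//.
apply: (@le_trans _ _ (\int[mu]_y M%:E)%E).
  apply: ge0_le_integral => //.
  - by move=> y _; rewrite lee_fin mass_ge0.
  - by apply/measurable_EFinP; exact: measurable_mass.
  - by move=> y _; rewrite lee_fin.
by rewrite integral_cst// [X in (_ * X)%E]probability_setT mule1.
Qed.

Lemma mass_cat_le b u s r M : uniq (u ++ s) ->
  (forall w, mass b s w r <= M) -> forall w, mass b (u ++ s) w r <= M.
Proof.
elim: u => //= k u ih /andP[ku us] hM; apply: mass_cons_le; last exact: ih.
by rewrite /= ku.
Qed.

(** Quantities that are at most [M] have an average of at least [M - eta]. Were they all below
    [M - 2 eta / p] on [A], whose measure is at least [p], the average would be at most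
    [M - 2 eta]. *)
Lemma mass_near_max b k s r M eta p w (A : set (R * R)) : uniq (k :: s) ->
  (forall w', mass b s w' r <= M) -> 0 < eta -> 0 < p ->
  measurable A -> (p%:E <= mu A)%E -> M - eta <= mass b (k :: s) w r ->
  exists2 y, A y & M - 2 / p * eta <= mass b s (w - cplx y * b k) r.
Proof.
move=> uks hM eta0 p0 mA pA hw; apply: contrapT => hN.
set c := 2 / p * eta.
have c0 : 0 < c by rewrite mulr_gt0// divr_gt0.
have lt_mass y : A y -> mass b s (w - cplx y * b k) r <= M - c.
  by move=> Ay; rewrite leNgt; apply/negP => h; apply: hN; exists y => //; exact: ltW.
suff : M - eta + c * p <= M.
  by rewrite /c mulrAC divfK ?gt_eqF//; lra.
rewrite -lee_fin EFinD; apply: (@le_trans _ _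
    (\int[mu]_y (mass b s (w - cplx y * b k) r + c * \1_A y)%:E)%E); last first.
  apply: (@le_trans _ _ (\int[mu]_y M%:E)%E); last first.
    by rewrite integral_cst// [X in (_ * X)%E]probability_setT mule1.
  apply: ge0_le_integral => //.
  - by move=> y _; rewrite lee_fin addr_ge0 ?mass_ge0// mulr_ge0// ltW.
  - apply/measurable_EFinP; apply: measurable_funD; first exact: measurable_mass.
    by apply: measurable_funM => //; exact: measurable_indic.
  - move=> y _; rewrite lee_fin indicE; have [yA|yA] := boolP (y \in A).
      by rewrite mulr1 -lerBrDr lt_mass//; exact: set_mem.
    by rewrite mulr0 addr0.
have m1 : measurable_fun setT (fun y : R * R => (mass b s (w - cplx y * b k) r)%:E).
  by apply/measurable_EFinP; exact: measurable_mass.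
have m2 : measurable_fun setT (fun y : R * R => (c * \1_A y)%:E).
  by apply/measurable_EFinP; apply: measurable_funM => //; exact: measurable_indic.
have m3 : measurable_fun setT (fun y : R * R => (\1_A y)%:E : \bar R).
  by apply/measurable_EFinP; exact: measurable_indic.
under eq_integral do rewrite EFinD.
rewrite ge0_integralD//; last 2 first.
- by move=> y _; rewrite lee_fin mass_ge0.
- by move=> y _; rewrite lee_fin mulr_ge0// ltW.
rewrite -mass_cons// leeD ?lee_fin//.
under eq_integral do rewrite EFinM.
rewrite ge0_integralZl_EFin//; last exact: ltW.
by rewrite integral_indic// setIT EFinM lee_pmul// lee_fin ltW.
Qed.

(* [t] lists steps [(k, c)], where the summand [a k * b k] is to stay within
   [err] of [v * c]. *)
Lemma mass_chain b (v : R[i]) (A : R * R -> set (R * R)) err p r M s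
    (t : seq (nat * (R * R))) : 0 < p ->
  (forall w, mass b s w r <= M) -> uniq (map fst t ++ s) ->
  (forall kc, kc \in t -> [/\ measurable (A kc.2), (p%:E <= mu (A kc.2))%E &
     forall y, A kc.2 y -> abs (cplx y * b kc.1 - v * cplx kc.2) <= err]) ->
  forall eta w, 0 < eta -> M - eta <= mass b (map fst t ++ s) w r ->
  exists2 w', abs (w' - (w - \sum_(kc <- t) v * cplx kc.2)) <= err *+ size t &
    M - (2 / p) ^+ size t * eta <= mass b s w' r.
Proof.
move=> p0 hM; elim: t => [|[k c] t ih] /= ut ht eta w eta0 hw.
  exists w; last by rewrite expr0 mul1r.
  by rewrite big_nil subr0 subrr abs0 mulr0n.
have /ht/= [mA pA hA] : (k, c) \in (k, c) :: t by rewrite mem_head.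
have ut' : uniq (map fst t ++ s) by case/andP: ut.
have [y Ay hy] := mass_near_max ut (mass_cat_le ut' hM) eta0 p0 mA pA hw.
have [||w' w'1 w'2] := ih ut' _ (2 / p * eta) (w - cplx y * b k) _ hy.
- by move=> kc kct; apply: ht; rewrite inE kct orbT.
- by rewrite mulr_gt0// divr_gt0.
exists w'; last by rewrite exprSr -mulrA.
rewrite big_cons /= (_ : _ - _ = w' - (w - cplx y * b k - \sum_(kc <- t) v * cplx kc.2)
    - (cplx y * b k - v * cplx c)); last by ring.
by rewrite (le_trans (absD _ _))// absN mulrS addrC lerD// hA.
Qed.

(** Points of a square are within [2 r] of its centre, so these squares are disjoint and their
    probabilities add up. *)
Lemma sum_mass_le1 b s r (m : nat) (w : nat -> R[i]) :
  (forall i j, (i < m)%N -> (j < m)%N -> i != j -> r *+ 4 < abs (w i - w j)) ->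
  \sum_(i < m) mass b s (w i) r <= 1.
Proof.
move=> hw; rewrite -lee_fin -sumEFin.
under eq_bigr do rewrite massE.
rewrite -measure_semi_additive_ord//.
- apply: probability_le1; apply: bigsetU_measurable => i _.
  exact: measurable_psum_sqbox.
- by move=> i; exact: measurable_psum_sqbox.
- apply/trivIsetP => i j _ _ ij; apply/seteqP; split => // t /= [hi hj].
  have := hw i j (ltn_ord i) (ltn_ord j) ij; rewrite ltNge => /negP; apply.
  have := sqbox_abs hi; have := sqbox_abs hj; rewrite absB => h1 h2.
  rewrite (_ : w i - w j = - (cplx (psum a b s t) - w i) +
    - (w j - cplx (psum a b s t))); last by ring.
  rewrite (le_trans (absD _ _))// !absN.
  by rewrite (_ : r *+ 4 = r *+ 2 + r *+ 2) ?lerD// -mulrnDr.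
- by apply: bigsetU_measurable => i _; exact: measurable_psum_sqbox.
Qed.

End Concentration.

(** * Anticoncentration of L_n at a fixed point *)

Section Anticoncentration.
Context (R : realType) (d : measure_display) (T : measurableType d).
Context (P : probability T R).

Lemma sqbox_subset (v w : R[i]) (r s : R) :
  abs (v - w) + r <= s -> sqbox v r `<=` sqbox w s.
Proof.
have re_le (x : R * R) : `|re (cplx x - w)| <= `|re (cplx x - v)| + abs (v - w).
  rewrite (_ : cplx x - w = (cplx x - v) + (v - w)); last by ring.
  rewrite (_ : re _ = re (cplx x - v) + re (v - w)); last first.
    by case: (cplx x - v) => ? ?; case: (v - w).
  by rewrite (le_trans (ler_normD _ _))// lerD2l normr_Re_le_abs.
have im_le (x : R * R) : `|im (cplx x - w)| <= `|im (cplx x - v)| + abs (v - w).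
  rewrite (_ : cplx x - w = (cplx x - v) + (v - w)); last by ring.
  rewrite (_ : im _ = im (cplx x - v) + im (v - w)); last first.
    by case: (cplx x - v) => ? ?; case: (v - w).
  by rewrite (le_trans (ler_normD _ _))// lerD2l normr_Im_le_abs.
move=> h x [h1 h2]; split.
  by rewrite (le_trans (re_le x))// (le_trans _ h)// addrC lerD2l.
by rewrite (le_trans (im_le x))// (le_trans _ h)// addrC lerD2l.
Qed.

Lemma exists_rat_near (x e : R) : 0 < e -> exists q : rat, `|x - ratr q| < e.
Proof.
move=> e0; have /rat_in_itvoo[q] : x - e < x + e by lra.
rewrite in_itv /= => /andP[q1 q2]; exists q.
by rewrite distrC ltr_distl q1 q2.
Qed.

(** Only countably many squares have rational data, so almost surely [X] avoids all those of
    probability zero, and then its value lies in the support. Were all these values equal, [X] would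
    be degenerate. *)
Lemma two_support_points (X : {RV P >-> (R * R)%type}) : ~ degenerate X ->
  exists x y, x <> y /\ forall r, 0 < r ->
    (0 < distribution P X (sqbox (cplx x) r))%E /\
    (0 < distribution P X (sqbox (cplx y) r))%E.
Proof.
move=> Xnd.
have mXbox v r : measurable (X @^-1` sqbox v r).
  by apply: measurable_funPTI; exact: measurable_sqbox.
pose box (q : rat * rat * nat) : set T :=
  X @^-1` sqbox (cplx (ratr q.1.1, ratr q.1.2)) q.2.+1%:R^-1.
pose F i : set T := if unpickle i is Some q then
  (if P (box q) == 0%E then box q else set0) else set0.
have Fneg : P.-negligible (\bigcup_i F i).
  apply: negligible_bigcup => i; rewrite /F; case: unpickle => [q|]; last first.
    exact: negligible_set0.
  case: eqP => [q0|_]; last exact: negligible_set0.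
  by apply/negligibleP => //; exact: mXbox.
have suppX t : ~ (\bigcup_i F i) t -> forall r, 0 < r ->
    (0 < distribution P X (sqbox (cplx (X t)) r))%E.
  move=> Ft r r0; rewrite lt_neqAle measure_ge0 andbT eq_sym; apply/eqP => XP0.
  (* A rational square of half-side below [r / 3] that contains [X t] lies in the square of
     half-side [r] about [X t]. *)
  apply: Ft; have [n n0] : exists n : nat, n.+1%:R^-1 < r / 3.
    have /ltr_add_invr[n] : 0 < r / 3 by rewrite divr_gt0.
    by rewrite add0r => ?; exists n.
  have e0 : 0 < n.+1%:R^-1 :> R by rewrite invr_gt0.
  have [q1 hq1] := exists_rat_near (X t).1 e0.
  have [q2 hq2] := exists_rat_near (X t).2 e0.
  exists (pickle ((q1, q2), n)); first exact: I.
  rewrite /F pickleK.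
  have habs : abs (cplx (ratr q1, ratr q2) - cplx (X t)) <= n.+1%:R^-1 *+ 2.
    by rewrite (le_trans (abs_le_ReIm _))//= mulr2n lerD// distrC ltW.
  have -> : P (box ((q1, q2), n)) = 0%E.
    apply/eqP; rewrite eq_le measure_ge0 andbT -XP0.
    apply: le_measure; rewrite ?inE//; try exact: mXbox.
    apply: preimage_subset; apply: sqbox_subset.
    apply: (le_trans (lerD habs (lexx _))) => /=.
    by move: n0; set i := n.+1%:R^-1; rewrite mulr2n => n0; lra.
  by rewrite eqxx; split => /=; exact: ltW.
have [t0 Ft0] : exists t, ~ (\bigcup_i F i) t.
  apply: contrapT => /forallNP hF.
  have : P.-negligible [set: T].
    by apply: negligibleS Fneg => t _; exact: contrapT (hF t).
  move=> /negligibleP -/(_ measurableT) PT0.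
  by have /eqP := probability_setT P; rewrite [P _]PT0 eq_sym onee_eq0.
have [t1 Ft1 t10] : exists2 t, ~ (\bigcup_i F i) t & X t0 <> X t.
  apply: contrapT => h; apply: Xnd; exists (X t0).
  apply: negligibleS Fneg => t /= Xt; apply: contrapT => Ft; apply: h.
  by exists t => // Xt0; apply: Xt; rewrite Xt0.
exists (X t0), (X t1); split => // r r0; split; exact: suppX.
Qed.

Lemma infinite_set_extend (G : set nat) (s : seq nat) (m : nat) :
  infinite_set G -> uniq s ->
  exists t, [/\ size t = m, uniq (t ++ s) & forall k, k \in t -> G k].
Proof.
move=> Ginf us; elim: m => [|m [t [st ut tG]]]; first by exists [::].
have /infinite_setN0[k [Gk kts]] : infinite_set (G `\` [set` (t ++ s)]).
  by apply: infinite_setD => //; exact: finite_seq.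
exists (k :: t); split => /=; first by rewrite st.
  by rewrite ut andbT; apply/negP.
by move=> j; rewrite inE => /predU1P[->|/tG].
Qed.

Context (a : nat -> {RV P >-> (R * R)%type}).
Hypothesis a_indep : mutually_independent a.
Hypothesis a_ident : identically_distributed a.
Hypothesis a_nondegenerate : ~ degenerate (a 0%N).

Let mu := distribution P (a 0%N).

Lemma sum_nseq (n : nat) (x : R * R) (v : R[i]) :
  \sum_(c <- nseq n x) v * cplx c = (v * cplx x) *+ n.
Proof. by rewrite big_nseq iter_addr_0. Qed.

Lemma mul_near (b beta : R[i]) (x y : R * R) (r tau : R) : abs (b - beta) <= tau ->
  sqbox (cplx x) r y -> 0 <= tau ->
  abs (cplx y * b - beta * cplx x) <=
    (abs (cplx x) + r *+ 2) * tau + abs beta * (r *+ 2).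
Proof.
move=> hb /sqbox_abs hy tau0.
rewrite (_ : cplx y * b - beta * cplx x =
  cplx y * (b - beta) + beta * (cplx y - cplx x)); last by ring.
rewrite (le_trans (absD _ _))// !absM lerD ?ler_wpM2l ?abs_ge0//.
apply: ler_pM; rewrite ?abs_ge0//.
rewrite (_ : cplx y = cplx x + (cplx y - cplx x)); last by ring.
by rewrite (le_trans (absD _ _))// lerD2l.
Qed.

(* Let [c] be the supremum of the levels reached by the concentration function
   of every finite sum over good indices.  A sum whose concentration is about
   [c], followed by [m] further good steps, still reaches about [c], so by
   [mass_near_max] each pattern of steps ([j] near [beta * x], then [m - j]
   near [beta * y]) leads to a box of mass about [c].  These [m + 1] boxes are
   disjoint, whence [c <= 1 / (m + 1)]. *)
Lemma concentration_vanishes (b : nat -> R[i]) (beta : R[i]) : beta != 0 ->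
  (forall tau, 0 < tau -> infinite_set [set k | abs (b k - beta) < tau]) ->
  exists2 delta : R, 0 < delta & forall theta : R, 0 < theta ->
    exists2 s, uniq s & forall w, mass a b s w delta <= theta.
Proof.
move=> beta0 hb; have [x [y [xy supp]]] := two_support_points a_nondegenerate.
pose D := abs (beta * (cplx x - cplx y)).
have D0 : 0 < D.
  rewrite abs_gt0 mulf_neq0// subr_eq0; apply/eqP => h; apply: xy.
  by case: x y h {supp D} => x1 x2 [y1 y2] [-> ->].
(* Different patterns aim at centres at least [D] apart and miss them by at most [D / 4] each; the
   remaining [D / 2] exceeds four half-sides. *)
exists (D / 16) => [|theta theta0]; first by rewrite divr_gt0.
apply: contrapT => hN.
have reach s : uniq s -> exists w, theta <= mass a b s w (D / 16).
  move=> us; apply: contrapT => /forallNP h; apply: hN; exists s => // w.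
  by rewrite leNgt; apply/negP => /ltW; exact: h.
have [m hm] : exists m : nat, m.+1%:R^-1 < theta / 2.
  have /ltr_add_invr[m] : 0 < theta / 2 by rewrite divr_gt0.
  by rewrite add0r => ?; exists m.
(* Over [m] steps the errors add up to at most [D / 4]. *)
pose err := D / 4 / m.+1%:R.
have err0 : 0 < err by rewrite !divr_gt0.
(* [r] controls the variable and [tau] the distance from [b k] to [beta]; each costs at most
   [err / 2] in [mul_near]. *)
pose r := Num.min 1 (err / 2 / (2 * (abs beta + 1))).
have r0 : 0 < r.
  rewrite lt_min ltr01 /= divr_gt0 ?divr_gt0// mulr_gt0//.
  by rewrite ltr_wpDl ?abs_ge0.
pose K := abs (cplx x) + abs (cplx y) + 2.
have K0 : 0 < K by rewrite ltr_wpDl ?addr_ge0 ?abs_ge0.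
pose tau := err / 2 / K.
have tau0 : 0 < tau by rewrite !divr_gt0.
have step_err k c q : c = x \/ c = y -> abs (b k - beta) < tau ->
    sqbox (cplx c) r q -> abs (cplx q * b k - beta * cplx c) <= err.
  move=> cxy hk hq; apply: (le_trans (mul_near (ltW hk) hq (ltW tau0))).
  rewrite (_ : err = K * tau + err / 2); last first.
    by rewrite /tau mulrC divfK ?gt_eqF//; field.
  have r1 : r <= 1 by rewrite ge_min lexx.
  apply: lerD.
    rewrite ler_pM2r// /K.
    have := abs_ge0 (cplx x); have := abs_ge0 (cplx y).
    by move: r1; rewrite mulr2n; case: cxy => ->; lra.
  have : r <= err / 2 / (2 * (abs beta + 1)) by rewrite ge_min lexx orbT.
  have b1 : 0 < abs beta + 1 by rewrite ltr_wpDl ?abs_ge0.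
  rewrite ler_pdivlMr ?mulr_gt0// => h; apply: le_trans h.
  have := abs_ge0 beta; rewrite mulr2n => b0; nra.
pose G := [set k | abs (b k - beta) < tau].
have Ginf : infinite_set G by exact: hb.
pose C := [set c : R | c <= 1 /\ forall s, uniq s -> (forall k, k \in s -> G k) ->
  exists w, c <= mass a b s w (D / 16)].
have Ctheta : C theta.
  split => [|s us _]; last exact: reach.
  by have [w] := reach [::] isT; move/le_trans; apply; exact: mass_le1.
have supC : has_sup C by split; [exists theta|exists 1 => c []].
have [mx my] := supp _ r0.
have mbox v : measurable (sqbox v r) by exact: measurable_sqbox.
have [p p0 [px py]] : exists2 p : R, 0 < p & (p%:E <= mu (sqbox (cplx x) r))%E /\
    (p%:E <= mu (sqbox (cplx y) r))%E.
  exists (Num.min (fine (mu (sqbox (cplx x) r))) (fine (mu (sqbox (cplx y) r)))).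
    by rewrite lt_min !fine_gt0//= ?mx ?my ltey_eq fin_num_measure.
  have fx : mu (sqbox (cplx x) r) \is a fin_num by exact: fin_num_measure.
  have fy : mu (sqbox (cplx y) r) \is a fin_num by exact: fin_num_measure.
  rewrite -[X in (_ <= X)%E /\ _](fineK fx) -[X in _ /\ (_ <= X)%E](fineK fy).
  by rewrite !lee_fin !ge_min !lexx orbT.
pose Q := (2 / p) ^+ m.
have Q0 : 0 < Q by rewrite exprn_gt0// divr_gt0.
(* A chain of [m] steps multiplies the defect by [Q], so the initial defect [2 eta] becomes
   [theta / 2]. *)
pose eta := theta / 2 / Q / 2.
have eta0 : 0 < eta by rewrite !divr_gt0.
pose M := sup C + eta.
(* [M] exceeds the supremum of [C], so it is not a level reached by all sums, and some [s0] has all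
   its masses at most [M]. *)
have [s0 [us0 s0G hM]] : exists s, [/\ uniq s, forall k, k \in s -> G k &
    forall w, mass a b s w (D / 16) <= M].
  apply: contrapT => h; suff : C M.
    by move=> /(sup_upper_bound supC); rewrite /M; lra.
  have reachM s : uniq s -> (forall k, k \in s -> G k) ->
      exists w, M <= mass a b s w (D / 16).
    move=> us sG; apply: contrapT => /forallNP hw; apply: h; exists s; split => // w.
    by rewrite leNgt; apply/negP => /ltW; exact: hw.
  split => //; have [w] := reachM [::] isT (fun k => ltac:(by [])).
  by move/le_trans; apply; exact: mass_le1.
have [c Cc hc] := sup_adherent eta0 supC.
have [t [st ut tG]] := infinite_set_extend m Ginf us0.
(* All indices of [t ++ s0] are good, so this sum reaches a level above [sup C - eta], which is
   [M - 2 eta]. *)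
have [w hw] : exists w, M - eta *+ 2 <= mass a b (t ++ s0) w (D / 16).
  have [|w hw] := Cc.2 _ ut.
    by move=> k; rewrite mem_cat => /orP[/tG|/s0G].
  by exists w; apply: le_trans hw; rewrite /M mulr2n; lra.
pose pat j := zip t (nseq j x ++ nseq (m - j) y).
have szpat j : (j <= m)%N -> size t = size (nseq j x ++ nseq (m - j) y).
  by move=> jm; rewrite size_cat !size_nseq subnKC.
pose e j := (beta * cplx x) *+ j + (beta * cplx y) *+ (m - j).
have /choice[W hW] : forall j, exists v : R[i], (j <= m)%N ->
    abs (v - (w - e j)) <= err *+ m /\ M - theta / 2 <= mass a b s0 v (D / 16).
  move=> j.
  have [jm|_] := leqP j m; last by exists 0.
  have fst_pat : map fst (pat j) = t.
    by rewrite -/(unzip1 (pat j)) unzip1_zip// (szpat j jm).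
  have eta2 : 0 < eta *+ 2 by rewrite mulrn_wgt0.
  have [||||w' h1 h2] := @mass_chain _ _ _ P a a_indep a_ident b beta
    (fun c => sqbox (cplx c) r) err p (D / 16) M s0 (pat j) p0 hM _ _ (eta *+ 2) w.
  - by rewrite fst_pat.
  - move=> [k q] kq; have kt : k \in t.
      by rewrite -fst_pat; apply/mapP; exists (k, q).
    have qxy : q = x \/ q = y.
      have : q \in unzip2 (pat j) by apply/mapP; exists (k, q).
      rewrite unzip2_zip ?(szpat j jm)// mem_cat.
      by move=> /orP[] /nseqP[-> _]; [left|right].
    split => //=; first by case: qxy => ->.
    by move=> q' hq'; apply: step_err => //; exact: tG.
  - exact: eta2.
  - by rewrite fst_pat.
  exists w' => _; split.
    move: h1; rewrite size_zip -(szpat j jm) minnn st.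
    suff -> : \sum_(kc <- pat j) beta * cplx kc.2 = e j by [].
    rewrite -(big_map snd xpredT (fun c => beta * cplx c)) -/(unzip2 _).
    by rewrite unzip2_zip ?(szpat j jm)// big_cat /= !sum_nseq.
  apply: le_trans h2; rewrite size_zip -(szpat j jm) minnn st -/Q.
  rewrite lerD2l lerN2 /eta mulr2n -mulr2n -[X in _ * X]mulr_natr divfK//.
  by rewrite mulrC divfK ?gt_eqF.
have errm : err *+ m <= D / 4.
  rewrite -mulr_natr /err -mulrA ler_piMr ?divr_ge0 ?(ltW D0)//.
  by rewrite mulrC ler_pdivrMr// mul1r ler_nat.
have sepW i j : (i < j <= m)%N -> (D / 16) *+ 4 < abs (W i - W j).
  move=> /andP[ij jm]; have im := leq_trans (ltnW ij) jm.
  have [h1 _] := hW i im; have [h2 _] := hW j jm.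
  have eij : e j - e i = (beta * (cplx x - cplx y)) *+ (j - i).
    rewrite /e -{1}(subnKC (ltnW ij)).
    have -> : (m - i = (m - j) + (j - i))%N by rewrite addnBA ?(ltnW ij)// subnK.
    by rewrite !mulrnDr mulrBr mulrnBl; ring.
  have : D <= abs ((W i - W j) - (W i - (w - e i)) + (W j - (w - e j))).
    rewrite (_ : _ + _ = e j - e i); last by ring.
    by rewrite eij absMn -/D -mulr_natr ler_peMr ?(ltW D0)// ler1n subn_gt0.
  move=> /le_trans/(_ (absD _ _)).
  have := absD (W i - W j) (- (W i - (w - e i))); rewrite absN.
  by rewrite -[_ *+ 4]mulr_natr; lra.
have sep : (forall i j, (i < m.+1)%N -> (j < m.+1)%N -> i != j ->
    D / 16 *+ 4 < abs (W i - W j)).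
  move=> i j; rewrite !ltnS => im jm; rewrite neq_ltn => /orP[ij|ji].
    by apply: sepW; rewrite ij.
  by rewrite absB; apply: sepW; rewrite ji.
(* As [theta] is in [C], each of the [m + 1] masses is at least [M - theta / 2 >= theta / 2]; by the
   choice of [m] their sum exceeds 1. *)
have := @sum_mass_le1 _ _ _ P a b s0 (D / 16) m.+1 W sep.
apply/negP; rewrite -ltNge.
apply: (@lt_le_trans _ _ (\sum_(i < m.+1) (theta / 2))).
  rewrite sumr_const card_ord -[ltRHS]mulr_natr.
  by rewrite -ltr_pdivrMr ?ltr0n// div1r.
apply: ler_sum => i _; apply: le_trans (hW i (ltnSE (ltn_ord i))).2.
have := sup_upper_bound supC Ctheta; rewrite /M.
by have := eta0; lra.
Qed.

(** Take the finite list that [concentration_vanishes] gives for the weights 1 / (w - z_k). Once [n]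
    exceeds its indices, L_n(w) is that sum plus independent terms, which cannot raise the
    concentration. The same [delta] serves every [theta]. *)
Lemma anticoncentration (z : nat -> R[i]) (w beta : R[i]) : beta != 0 ->
  (forall tau, 0 < tau -> infinite_set [set k | abs ((w - z k)^-1 - beta) < tau]) ->
  exists2 delta : R, 0 < delta & forall theta : R, 0 < theta ->
    \forall n \near \oo,
      (P [set t | (abs (L (fun k => cplx (a k t)) z n w) < delta)%R] <= theta%:E)%E.
Proof.
move=> beta0 hbeta.
have [delta delta0 h] := concentration_vanishes beta0 hbeta.
exists delta => // theta /h[s us hs].
exists (\max_(k <- s) k).+1 => // n /= sn.
pose b k := (w - z k)^-1.
have LE t : L (fun k => cplx (a k t)) z n w = wsum a b (iota 0 n) t.
  rewrite /L /wsum (_ : iota 0 n = index_iota 0 n) ?big_mkord//.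
  by rewrite /index_iota subn0.
have sub : {subset s <= iota 0 n}.
  move=> k ks; rewrite mem_iota /= add0n (leq_ltn_trans _ sn)//.
  exact: (leq_bigmax_seq (F := id) _ ks isT).
pose u := [seq k <- iota 0 n | k \notin s].
have perm_us : perm_eq (u ++ s) (iota 0 n).
  apply: uniq_perm; last 2 first.
  - exact: iota_uniq.
  - move=> k; rewrite mem_cat mem_filter; have [ks|//] := boolP (k \in s).
      by rewrite (sub _ ks) orbT.
    by rewrite /= orbF.
  rewrite cat_uniq filter_uniq ?iota_uniq//= us andbT.
  by apply/hasPn => k ks; rewrite mem_filter ks.
have mL : measurable [set t | (abs (L (fun k => cplx (a k t)) z n w) < delta)%R].
  have h1 : cmeasurable (fun t => L (fun k => cplx (a k t)) z n w).
    by under eq_fun do rewrite LE; exact: cmeasurable_wsum.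
  have := measurable_fun_ltr (measurable_abs h1) (measurable_cst delta).
  by move=> /(_ measurableT [set true] I); rewrite setTI.
apply: (@le_trans _ _ (mass a b (iota 0 n) 0 delta)%:E).
  rewrite massE; apply: le_measure; rewrite ?inE//.
    exact: measurable_psum_sqbox.
  move=> t /= hLt; apply: abs_sqbox; rewrite /psum plane_ofK subr0 -LE.
  exact: ltW.
rewrite lee_fin -(@mass_perm _ _ _ P a b _ _ 0 delta perm_us).
apply: mass_cat_le => //.
by rewrite (perm_uniq perm_us) iota_uniq.
Qed.

End Anticoncentration.


(** * Integrals of the inverse distance over a square *)

Section InverseDistance.
Variable R : realType.
Let plane := (measurableTypeR R * measurableTypeR R)%type.

(* The library equips products of measures with a sigma-finite structure only
   through products of subprobabilities, so the product Lebesgue measure gets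
   a name and a sigma-finite structure of its own. *)
Definition area : set plane -> \bar R := (@lebesgue_measure R \x @lebesgue_measure R)%E.

HB.instance Definition _ := Measure.on area.

Lemma sqbox_prod (w : R[i]) (r : R) :
  sqbox w r = `[re w - r, re w + r] `*` `[im w - r, im w + r].
Proof.
by apply/seteqP; split => -[x y] /=; rewrite /sqbox /= !in_itv /=;
  case: w => u v /=; rewrite !ler_distl.
Qed.

Lemma area_sqbox (w : R[i]) (r : R) : 0 <= r ->
  area (sqbox w r : set plane) = ((r *+ 2) ^+ 2)%:E.
Proof.
move=> r0; have itv x : lebesgue_measure (`[x - r, x + r]%classic : set R) = (r *+ 2)%:E.
  rewrite lebesgue_measure_itv /= lte_fin; case: ltP => h.
    by rewrite -EFinB; congr EFin; rewrite mulr2n; ring.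
  by congr EFin; rewrite mulr2n; lra.
rewrite sqbox_prod /area product_measure1E//.
by rewrite [X in (X * _)%E]itv [X in (_ * X)%E]itv -EFinM expr2.
Qed.

Lemma sigma_finite_area : sigma_finite setT area.
Proof.
exists (fun n : nat => sqbox 0%R n%:R : set plane) => [|n]; last first.
  split; first exact: measurable_sqbox.
  by rewrite area_sqbox// ltry.
apply/seteqP; split => // p _.
exists (Num.bound (abs (cplx p))) => //; apply: abs_sqbox.
by rewrite subr0 ltW// archi_boundP// abs_ge0.
Qed.

HB.instance Definition _ :=
  Measure_isSigmaFinite.Build _ _ _ area sigma_finite_area.

(** If [x] lies between 2^-(k+1) and 2^-k, the [k]-th term alone is at least 1/x; the summand 1
    covers [x >= 1], and at 0 the inverse is 0 by convention. *)
Lemma inv_le_dyadic_sum (x : R) : 0 <= x ->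
  (x^-1%:E <= 1 + \sum_(k <oo) ((2 ^ k.+1)%:R * (x <= (2 ^ k)%:R^-1)%R%:R)%:E)%E.
Proof.
move=> x0.
have S0 : (0 <= \sum_(k <oo) ((2 ^ k.+1)%:R * (x <= (2 ^ k)%:R^-1)%R%:R : R)%:E)%E.
  by apply: nneseries_ge0 => k _ _; rewrite lee_fin.
have [xe|xn0] := eqVneq x 0; first by rewrite {1}xe invr0 adde_ge0.
have xp : 0 < x by rewrite lt_neqAle eq_sym xn0.
have [x1|x1] := leP 1 x.
  by apply: (@le_trans _ _ 1%E); rewrite ?leeDl// lee_fin invf_le1.
have ex : exists k, (2 ^ k.+1)%:R^-1 <= x.
  have /ltr_add_invr[n] := xp; rewrite add0r => /ltW nx; exists n.
  apply: le_trans nx; rewrite lef_pV2 ?posrE ?ltr0n ?expn_gt0// ler_nat.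
  exact: ltnW (ltn_expl _ _).
have [k hk kmin] := ex_minnP ex.
have xk : x <= (2 ^ k)%:R^-1.
  case: k {hk} kmin => [_|k kmin]; first by rewrite expn0 invr1 ltW.
  by rewrite leNgt; apply/negP => /ltW /kmin; rewrite ltnn.
apply: (@le_trans _ _ (\sum_(k <oo) ((2 ^ k.+1)%:R * (x <= (2 ^ k)%:R^-1)%R%:R : R)%:E)%E);
  last by rewrite leeDr.
apply: le_trans (nneseries_lim_ge k.+1 _); last by move=> i _ _; rewrite lee_fin.
rewrite big_nat_recr//= xk mulr1; apply: (@le_trans _ _ (2 ^ k.+1)%:R%:E).
  by rewrite lee_fin invf_ple ?posrE ?ltr0n ?expn_gt0.
by rewrite leeDr// sume_ge0// => i _; rewrite lee_fin.
Qed.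

(** In the dyadic bound the [k]-th square has area 4 / 4^k and weight 2^(k+1), so it contributes at
    most 8 / 2^k; the total is at most 16 wherever [zeta] lies. *)
Lemma integral_inv_dist (r : R) : 0 <= r -> exists K : R, forall zeta : R[i],
  (\int[area]_(p in (sqbox 0%R r : set plane)) (abs (cplx p - zeta))^-1%:E <= K%:E)%E.
Proof.
move=> r0; exists ((r *+ 2) ^+ 2 + 16) => zeta.
set D : set plane := sqbox 0%R r.
have mD : measurable D by exact: measurable_sqbox.
pose f k (p : plane) : \bar R :=
  ((2 ^ k.+1)%:R * \1_(sqbox zeta (2 ^ k)%:R^-1) p)%:E.
have f0 k p : (0 <= f k p)%E by rewrite lee_fin.
have mf k : measurable_fun D (f k).
  apply: measurable_funTS; apply/measurable_EFinP; apply: measurable_funM => //.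
  by apply: measurable_indic; exact: measurable_sqbox.
have mabs : measurable_fun D (fun p : plane => (abs (cplx p - zeta))^-1%:E).
  apply: measurable_funTS; apply/measurable_EFinP; apply: measurable_funV.
  apply: measurable_abs; apply: cmeasurableD; last exact: cmeasurable_cst.
  exact: (cmeasurable_cplx (@measurable_id _ _ _)).
apply: (@le_trans _ _ (\int[area]_(p in D) (1 + \sum_(k <oo) f k p))%E).
  apply: ge0_le_integral => //.
  - by move=> p _; rewrite lee_fin invr_ge0 abs_ge0.
  - by apply: emeasurable_funD => //; apply: ge0_emeasurable_sum => // k p _ _; exact: f0.
  - move=> p _; apply: le_trans (inv_le_dyadic_sum (abs_ge0 _)) _.
    rewrite leeD2l//; apply: lee_nneseries => [k _ _|k _]; first by rewrite lee_fin.
    rewrite lee_fin ler_wpM2l// indicE ler_nat.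
    by case: leP => // /abs_sqbox h; rewrite mem_set.
rewrite ge0_integralD//; last 2 first.
- by move=> p _; exact: nneseries_ge0.
- by apply: ge0_emeasurable_sum => // k p _ _; exact: f0.
rewrite integral_cst// mul1e [X in (X + _)%E]area_sqbox// EFinD leeD2l//.
rewrite integral_nneseries//.
apply: le_trans (epsilon_trick0 xpredT (_ : 0 <= 16 :> R)) => //.
apply: lee_nneseries => [k _ _|k _].
  by apply: integral_ge0 => p _; exact: f0.
rewrite /f; under eq_integral do rewrite EFinM.
rewrite ge0_integralZl_EFin//; last first.
  apply: measurable_funTS; apply/measurable_EFinP.
  by apply: measurable_indic; exact: measurable_sqbox.
rewrite integral_indic//; last exact: measurable_sqbox.
have e0 : 0 <= (2 ^ k)%:R^-1 :> R by rewrite invr_ge0.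
apply: (@le_trans _ _ ((2 ^ k.+1)%:R%:E * ((((2 ^ k)%:R^-1 *+ 2) ^+ 2 : R))%:E)%E).
  rewrite lee_wpmul2l// -(area_sqbox zeta e0); apply: le_measure; rewrite ?inE//.
  - by apply: measurableI => //; exact: measurable_sqbox.
  - exact: measurable_sqbox.
rewrite -EFinM lee_fin expnS natrM.
have k0 : (2 ^ k)%:R != 0 :> R by rewrite pnatr_eq0 expn_eq0.
by rewrite le_eqVlt; apply/orP; left; apply/eqP; rewrite mulr2n; field.
Qed.

End InverseDistance.

Arguments area : clear implicits.

(** * Pointwise bounds for the logarithm of L_n *)

Section LogarithmBounds.
Variable R : realType.

(** Comes from [ln (x / h) <= x / h]. A large [h] makes the coefficient of [x] small at the price of
    the constant [ln h]. *)
Lemma ln_le_linear (x h : R) : 0 <= x -> 1 <= h -> ln x <= ln h + x / h.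
Proof.
move=> x0 h1; have h0 : 0 < h by exact: lt_le_trans h1.
have [xe|xn0] := eqVneq x 0.
  by rewrite xe ln0// mul0r addr0 ln_ge0.
have xp : 0 < x by rewrite lt_neqAle eq_sym xn0.
have -> : ln x = ln h + ln (x / h).
  by rewrite -lnM ?posrE ?divr_gt0// mulrC divfK ?gt_eqF.
by rewrite lerD2l; exact: ltW (ln_sublinear (divr_gt0 xp h0)).
Qed.

(* With [N] the numerator of [L] over the common denominator [Q], both [N] and
   [Q] are split into linear factors and compared factor by factor at [w] and
   at [p]; the leading coefficient of [N] cancels. *)
Lemma L_growth (c z : nat -> R[i]) (n : nat) (w : R[i]) (C d0 : R) :
  0 <= C -> 0 < d0 -> (forall k, d0 <= abs (w - z k)) -> L c z n w != 0 ->
  exists2 s : seq R[i], (size s <= n)%N &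
    forall p, (forall k, p != z k) -> abs (p - w) <= C -> L c z n p != 0 ->
      abs (L c z n w) <= abs (L c z n p) *
        \prod_(x <- s) (1 + C * (abs (p - x))^-1) * (1 + C / d0) ^+ n.
Proof.
move=> C0 d00 wz Lw0.
pose Q p := \prod_(k < n) (p - z k).
pose N : {poly R[i]} := \sum_(k < n) c k *: \prod_(i < n | i != k) ('X - (z i)%:P).
have wzk k : w != z k.
  by rewrite -subr_eq0 -abs_gt0; exact: lt_le_trans (wz k).
have NE p : (forall k, p != z k) -> N.[p] = L c z n p * Q p.
  move=> pz; rewrite /N horner_sum /L mulr_suml; apply: eq_bigr => k _.
  rewrite hornerZ horner_prod /Q [X in _ = _ * X](bigD1 k)//= mulrA.
  rewrite divfK ?subr_eq0//; congr (_ * _).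
  by apply: eq_bigr => i _; rewrite hornerXsubC.
have Qn0 p : (forall k, p != z k) -> Q p != 0.
  by move=> pz; apply/prodf_neq0 => k _; rewrite subr_eq0.
have N0 : N != 0.
  apply/eqP => N0; have := NE w wzk; rewrite N0 horner0 => /esym/eqP.
  by rewrite mulf_eq0 (negbTE Lw0) (negbTE (Qn0 _ wzk)).
have [s Ns] := closed_field_poly_normal N.
have lc0 : lead_coef N != 0 by rewrite lead_coef_eq0.
have Nhorner p : N.[p] = lead_coef N * \prod_(x <- s) (p - x).
  rewrite {1}Ns hornerZ horner_prod; congr (_ * _).
  by apply: eq_bigr => x _; rewrite hornerXsubC.
exists s.
  rewrite -ltnS -(size_prod_XsubC s id) -(size_scale _ lc0) -Ns.
  apply: (leq_trans (size_sum _ _ _)); apply/bigmax_leqP => k _.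
  apply: (leq_trans (size_scale_leq _ _)).
  rewrite -big_filter size_prod_XsubC ltnS size_filter.
  by rewrite (leq_trans (count_size _ _))// -sum1_size sum1_card card_ord.
move=> p pz pw Lp0.
(* [p] is no zero of the numerator because L_n(p) is not 0, so the distances to the zeros can be
   divided by. *)
have px x : x \in s -> p != x.
  move=> xs; apply/eqP => px; have /eqP := NE p pz; rewrite Nhorner px.
  rewrite (big_rem x)//= subrr mul0r mulr0 eq_sym mulf_eq0 -px (negbTE Lp0).
  by rewrite (negbTE (Qn0 _ pz)).
have Nle : abs N.[w] <= abs N.[p] * \prod_(x <- s) (1 + C * (abs (p - x))^-1).
  rewrite !Nhorner !absM -mulrA ler_wpM2l ?abs_ge0// !abs_prod -big_split/=.
  rewrite big_seq [leRHS]big_seq; apply: ler_prod => x xs; rewrite abs_ge0/=.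
  have px0 : 0 < abs (p - x) by rewrite abs_gt0 subr_eq0 px.
  rewrite mulrDr mulr1 mulrCA divff ?gt_eqF// mulr1.
  rewrite (_ : w - x = (p - x) + (w - p)); last by ring.
  by rewrite (le_trans (absD _ _))// lerD2l absB.
(* Since |w - z_k| >= [d0], the added distance [C] amounts to at most a factor 1 + C / d0. *)
have Qle : abs (Q p) <= abs (Q w) * (1 + C / d0) ^+ n.
  rewrite /Q !abs_prod -[X in _ ^+ X]card_ord -prodr_const -big_split/=.
  apply: ler_prod => k _; rewrite abs_ge0/=.
  rewrite (_ : p - z k = (w - z k) + (p - w)); last by ring.
  rewrite (le_trans (absD _ _))// mulrDr mulr1 lerD2l (le_trans pw)//.
  by rewrite mulrCA ler_peMr// ler_pdivlMr// mul1r.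
have Qw0 : 0 < abs (Q w) by rewrite abs_gt0 Qn0.
have prod0 : 0 <= \prod_(x <- s) (1 + C * (abs (p - x))^-1).
  by apply: prodr_ge0 => x _; rewrite addr_ge0// mulr_ge0// invr_ge0 abs_ge0.
rewrite -(ler_pM2r Qw0) -absM -NE// (le_trans Nle)// NE// absM.
rewrite -!mulrA ler_wpM2l ?abs_ge0// [abs (Q p) * _]mulrC ler_wpM2l//.
by rewrite mulrC.
Qed.

(** Logarithm of [L_growth]: the lower bound at [w] costs [n], the poles cost n C / d0, and each of
    the at most [n] zeros costs [ln h + 1] plus C / h times its inverse distance, by [ln_le_linear]
    and 1 / h <= 1. *)
Lemma neg_ln_L_le (c z : nat -> R[i]) (n : nat) (w : R[i]) (C d0 h : R) :
  0 <= C -> 0 < d0 -> 1 <= h -> (forall k, d0 <= abs (w - z k)) ->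
  expR (- n%:R) <= abs (L c z n w) ->
  exists2 s : seq R[i], (size s <= n)%N &
    forall p, (forall k, p != z k) -> abs (p - w) <= C ->
      - ln (abs (L c z n p)) <= n%:R * (2 + C / d0 + ln h) +
        C / h * \sum_(x <- s) (abs (p - x))^-1.
Proof.
move=> C0 d00 h1 wz Lw; have h0 : 0 < h by exact: lt_le_trans h1.
have Lw0 : 0 < abs (L c z n w) by exact: lt_le_trans (expR_gt0 _) Lw.
have lnh0 : 0 <= ln h by exact: ln_ge0.
have [|s ns hs] := L_growth (n := n) (c := c) C0 d00 wz; first by rewrite -abs_gt0.
exists s => // p pz pw.
have S0 : 0 <= \sum_(x <- s) (abs (p - x))^-1.
  by apply: sumr_ge0 => x _; rewrite invr_ge0 abs_ge0.
(* At a zero of L_n the logarithm is 0 by convention and the right-hand side is nonnegative. *)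
have [Lp|Lp] := eqVneq (L c z n p) 0.
  rewrite Lp abs0 ln0// oppr0 addr_ge0// mulr_ge0 ?divr_ge0 ?(ltW h0)//.
  by rewrite !addr_ge0 ?divr_ge0// ltW.
have F0 x : 0 < 1 + C * (abs (p - x))^-1.
  by rewrite ltr_wpDr// mulr_ge0// invr_ge0 abs_ge0.
have P0 : 0 < \prod_(x <- s) (1 + C * (abs (p - x))^-1) by exact: prodr_gt0.
have E0 : 0 < 1 + C / d0 by rewrite ltr_wpDr// divr_ge0// ltW.
have := hs p pz pw Lp; rewrite -ler_ln ?posrE//; last first.
  by rewrite !mulr_gt0 ?exprn_gt0 ?abs_gt0.
rewrite !lnM ?posrE ?mulr_gt0 ?exprn_gt0 ?abs_gt0// lnXn//.
have : - n%:R <= ln (abs (L c z n w)) by rewrite -ler_expR lnK.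
have : ln (1 + C / d0) *+ n <= n%:R * (C / d0).
  rewrite -[leLHS]mulr_natl ler_wpM2l// le_ln1Dx// (lt_le_trans (ltrN10 _))//.
  by rewrite divr_ge0// ltW.
have : ln (\prod_(x <- s) (1 + C * (abs (p - x))^-1)) <=
    n%:R * (ln h + 1) + C / h * \sum_(x <- s) (abs (p - x))^-1.
  have -> : ln (\prod_(x <- s) (1 + C * (abs (p - x))^-1)) =
      \sum_(x <- s) ln (1 + C * (abs (p - x))^-1).
    elim: (s) => [|x s' ih]; first by rewrite !big_nil ln1.
    by rewrite !big_cons lnM ?posrE// ?ih// prodr_gt0.
  apply: (@le_trans _ _ (\sum_(x <- s) ((ln h + 1) + C / h * (abs (p - x))^-1))).
    apply: ler_sum => x _; apply: (le_trans (ln_le_linear (ltW (F0 x)) h1)).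
    rewrite mulrDl mul1r addrA mulrAC lerD2r lerD2l.
    by rewrite invf_le1.
  rewrite big_split/= -mulr_sumr lerD2r big_const_seq count_predT iter_addr_0.
  by rewrite -[leLHS]mulr_natl ler_wpM2r ?addr_ge0// ler_nat.
rewrite !mulrDr; lra.
Qed.

End LogarithmBounds.

(** * The integral of |u_n| over a square *)

Section LogarithmIntegral.
Variable R : realType.
Let plane := (measurableTypeR R * measurableTypeR R)%type.

Lemma ae_off_sequence (z : nat -> R[i]) :
  {ae area R, forall p : plane, forall k, cplx p != z k}.
Proof.
apply: (ae_foralln (P := fun k (p : plane) => cplx p != z k)) => k.
exists (sqbox (z k) 0 : set plane); split.
- exact: measurable_sqbox.
- by have := area_sqbox (z k) (lexx 0); rewrite mul0rn expr0n.
- move=> p /= /negP; rewrite negbK => /eqP pz.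
  by apply: abs_sqbox; rewrite pz subrr abs0.
Qed.

Definition logpot (c z : nat -> R[i]) (n : nat) (p : R * R) : R :=
  n%:R^-1 * ln (abs (L c z n (cplx p))).

Lemma measurable_inv_dist (zeta : R[i]) :
  measurable_fun setT (fun p : plane => (abs (cplx p - zeta))^-1).
Proof.
apply: measurable_funV; apply: measurable_abs.
apply: cmeasurableD; last exact: cmeasurable_cst.
exact: (cmeasurable_cplx (@measurable_id _ _ _)).
Qed.

Lemma measurable_logpot (d : measure_display) (T : measurableType d)
    (a : nat -> T -> R * R) (z : nat -> R[i]) (g : T -> R * R) (n : nat) :
  (forall k, measurable_fun setT (a k)) -> measurable_fun setT g ->
  measurable_fun setT (fun t => logpot (fun k => cplx (a k t)) z n (g t)).
Proof.
move=> ma mg; apply: measurable_funM => //.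
apply: (measurableT_comp (@measurable_ln R)).
by apply: measurable_abs; exact: measurable_L.
Qed.

(** The positive part is handled by [ln_le_linear] and the bound of |L_n| by the sum of the |a_k| /
    |p - z_k|. The negative part is at most [eps] off the set where [logpot] is below [- eps], and
    on it [neg_ln_L_le] divided by [n] applies; the constant of that bound is therefore needed on
    this set only. *)
Lemma normr_logpot_le (c z : nat -> R[i]) (n : nat) (w : R[i]) (C d0 h eps : R) :
  (0 < n)%N -> 0 <= C -> 0 < d0 -> 1 <= h -> 0 <= eps ->
  (forall k, d0 <= abs (w - z k)) -> expR (- n%:R) <= abs (L c z n w) ->
  exists2 s : seq R[i], (size s <= n)%N &
    forall p : R * R, (forall k, cplx p != z k) -> abs (cplx p - w) <= C ->
      `|logpot c z n p| <= eps + ln h / n%:R +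
        (2 + C / d0 + ln h) * (logpot c z n p < - eps)%R%:R +
        \sum_(x <- s) C / (h * n%:R) * (abs (cplx p - x))^-1 +
        \sum_(k < n) abs (c k) / (h * n%:R) * (abs (cplx p - z k))^-1.
Proof.
move=> n0 C0 d00 h1 eps0 wz Lw.
have [s sn hs] := neg_ln_L_le C0 d00 h1 wz Lw.
exists s => // p pz pw; have := hs _ pz pw.
have h0 : 0 < h by exact: lt_le_trans h1.
have N0 : 0 < n%:R :> R by rewrite ltr0n.
have lnh0 : 0 <= ln h by exact: ln_ge0.
have k0 : 0 <= 2 + C / d0 + ln h by rewrite !addr_ge0 ?divr_ge0// ltW.
have i0 x : 0 <= (abs (cplx p - x))^-1 by rewrite invr_ge0 abs_ge0.
rewrite -!mulr_sumr.
set S := \sum_(x <- s) _ => hneg.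
have S0 : 0 <= C / (h * n%:R) * S.
  by rewrite mulr_ge0 ?sumr_ge0// divr_ge0// mulr_ge0 ?(ltW h0)// ltW.
set A := \sum_(k < n) _.
have A0 : 0 <= A.
  apply: sumr_ge0 => k _; rewrite mulr_ge0// divr_ge0 ?abs_ge0//.
  by rewrite mulr_ge0 ?(ltW h0)// ltW.
have lnN0 : 0 <= ln h / n%:R by rewrite divr_ge0// ltW.
have lnL : ln (abs (L c z n (cplx p))) / n%:R <= ln h / n%:R + A.
  have := ln_le_linear (abs_ge0 (L c z n (cplx p))) h1.
  have LA : abs (L c z n (cplx p)) / h <= n%:R * A.
    rewrite /A mulr_sumr ler_pdivrMr// mulr_suml.
    apply: (le_trans (abs_sum _ _)); apply: ler_sum => k _.
    rewrite absM absV le_eqVlt; apply/orP; left; apply/eqP; field.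
    by rewrite !gt_eqF// abs_gt0 subr_eq0 pz.
  move=> hln; rewrite ler_pdivrMr// mulrDl divfK ?gt_eqF// [A * _]mulrC.
  by rewrite (le_trans hln)// lerD2l.
rewrite /logpot mulrC; set v := ln _ / n%:R in lnL *.
have hneg' : - v <= 2 + C / d0 + ln h + C / (h * n%:R) * S.
  rewrite /v -mulNr ler_pdivrMr// (le_trans hneg)// mulrDl lerD//.
    by rewrite mulrC.
  rewrite le_eqVlt; apply/orP; left; apply/eqP; field.
  by rewrite !gt_eqF.
have [v0|v0] := leP 0 v.
  rewrite ger0_norm//; have b0 : 0 <= (2 + C / d0 + ln h) * (v < - eps)%R%:R.
    by rewrite mulr_ge0.
  by lra.
rewrite ltr0_norm//; have [ve|ve] := ltP v (- eps).
  by rewrite mulr1; lra.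
by rewrite mulr0; lra.
Qed.

(** [normr_logpot_le] is integrated term by term. The zeros vary with [a], but there are at most [n]
    of them, of weight C / (h n) each, and [K] is uniform in the centre; the poles have total weight
    at most H / h. *)
Lemma integral_logpot_le (a : nat -> R * R) (z : nat -> R[i]) (n : nat)
    (w : R[i]) (r C d0 h eps K H eta : R) (D := sqbox 0 r : set plane)
    (v := logpot (fun k => cplx (a k)) z n) :
  (0 < n)%N -> 0 <= r -> 0 <= C -> 0 < d0 -> 1 <= h -> 0 <= eps -> 0 <= K ->
  (forall k, d0 <= abs (w - z k)) ->
  expR (- n%:R) <= abs (L (fun k => cplx (a k)) z n w) ->
  (forall p, D p -> abs (cplx p - w) <= C) ->
  (forall zeta : R[i],
    \int[area R]_(p in D) (abs (cplx p - zeta))^-1%:E <= K%:E)%E ->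
  \sum_(k < n) abs (cplx (a k)) <= n%:R * H ->
  (area R (D `&` [set p | (v p < - eps)%R]) <= eta%:E)%E ->
  (\int[area R]_(p in D) `|v p|%:E <=
    ((eps + ln h / n%:R) * (r *+ 2) ^+ 2 + (2 + C / d0 + ln h) * eta +
     C / h * K + H / h * K)%:E)%E.
Proof.
move=> n0 r0 C0 d00 h1 eps0 K0 wz Lw DC DK aH vbad.
have [s sn hs] := normr_logpot_le n0 C0 d00 h1 eps0 wz Lw.
have h0 : 0 < h by exact: lt_le_trans h1.
have N0 : 0 < n%:R :> R by rewrite ltr0n.
have hN0 : 0 < h * n%:R by rewrite mulr_gt0.
have lnh0 : 0 <= ln h by exact: ln_ge0.
have k0 : 0 <= 2 + C / d0 + ln h by rewrite !addr_ge0 ?divr_ge0// ltW.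
have mD : measurable D by exact: measurable_sqbox.
have mv : measurable_fun setT (v : plane -> R).
  by apply: (@measurable_logpot _ plane (fun k => cst (a k)) z id).
pose bad : set plane := [set p | (v p < - eps)%R].
have mbad : measurable bad.
  have := measurable_fun_ltr mv (measurable_cst (- eps)).
  by move=> /(_ measurableT [set true] I); rewrite setTI.
pose f0 (p : plane) : \bar R := (eps + ln h / n%:R)%:E.
pose f1 (p : plane) : \bar R := ((2 + C / d0 + ln h) * \1_bad p)%:E.
pose f2 (x : R[i]) (p : plane) : \bar R :=
  (C / (h * n%:R) * (abs (cplx p - x))^-1)%:E.
pose f3 (k : 'I_n) (p : plane) : \bar R :=
  (abs (cplx (a k)) / (h * n%:R) * (abs (cplx p - z k))^-1)%:E.
have i0 (p : plane) x : 0 <= (abs (cplx p - x))^-1 by rewrite invr_ge0 abs_ge0.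
have f00 p : (0 <= f0 p)%E by rewrite lee_fin addr_ge0// divr_ge0// ltW.
have f10 p : (0 <= f1 p)%E by rewrite lee_fin mulr_ge0.
have f20 x p : (0 <= f2 x p)%E.
  by rewrite lee_fin mulr_ge0// divr_ge0// ltW.
have f30 k p : (0 <= f3 k p)%E.
  by rewrite lee_fin mulr_ge0// divr_ge0 ?abs_ge0// ltW.
have mf0 : measurable_fun D f0 by exact: measurable_cst.
have mbad1 : measurable_fun setT (\1_bad : plane -> R) by exact: measurable_indic.
have mind : measurable_fun D (fun p => (\1_bad p)%:E : \bar R).
  by apply: measurable_funTS; apply/measurable_EFinP.
have mf1 : measurable_fun D f1.
  by apply: measurable_funTS; apply/measurable_EFinP; exact: measurable_funM.
have minv x : measurable_fun D (fun p : plane => (abs (cplx p - x))^-1%:E).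
  by apply: measurable_funTS; apply/measurable_EFinP; exact: measurable_inv_dist.
have mf2 x : measurable_fun D (f2 x).
  apply: measurable_funTS; apply/measurable_EFinP; apply: measurable_funM => //.
  exact: measurable_inv_dist.
have mf3 k : measurable_fun D (f3 k).
  apply: measurable_funTS; apply/measurable_EFinP; apply: measurable_funM => //.
  exact: measurable_inv_dist.
have ms2 : measurable_fun D (fun p => \sum_(x <- s) f2 x p)%E.
  by apply: emeasurable_sum => x.
have ms3 : measurable_fun D (fun p => \sum_(k < n) f3 k p)%E.
  by apply: emeasurable_sum => x.
have s20 p : (0 <= \sum_(x <- s) f2 x p)%E by apply: sume_ge0.
have s30 p : (0 <= \sum_(k < n) f3 k p)%E by apply: sume_ge0.
have inv_le (c : R) x : 0 <= c ->
    (\int[area R]_(p in D) (c * (abs (cplx p - x))^-1)%:E <= (c * K)%:E)%E.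
  move=> c0; under eq_integral do rewrite EFinM.
  rewrite ge0_integralZl_EFin//; last by move=> p _; rewrite lee_fin.
  by rewrite EFinM lee_wpmul2l// lee_fin.
apply: (@le_trans _ _ (\int[area R]_(p in D)
    (f0 p + f1 p + \sum_(x <- s) f2 x p + \sum_(k < n) f3 k p))%E).
  apply: ae_ge0_le_integral => //.
  - by apply: measurable_funTS; apply/measurable_EFinP; exact: measurableT_comp.
  - by move=> p _; rewrite !adde_ge0.
  - by do 3 (apply: emeasurable_funD => //).
  - apply: filterS (ae_off_sequence z) => p pz Dp.
    rewrite /f0 /f1 /f2 /f3 !sumEFin -!EFinD lee_fin indicE.
    have -> : (p \in bad) = (v p < - eps)%R.
      by apply/idP/idP => [|h']; [rewrite inE|rewrite inE].
    exact: hs pz (DC _ Dp).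
have m01 : measurable_fun D (fun p => f0 p + f1 p)%E by exact: emeasurable_funD.
have m012 : measurable_fun D (fun p => f0 p + f1 p + \sum_(x <- s) f2 x p)%E.
  exact: emeasurable_funD.
rewrite ge0_integralD//; last by move=> p _; rewrite !adde_ge0.
rewrite ge0_integralD//; last by move=> p _; rewrite !adde_ge0.
rewrite ge0_integralD// !EFinD; apply: leeD; [apply: leeD; [apply: leeD|]|].
- by rewrite integral_cst// [X in (_ * X)%E]area_sqbox// -EFinM.
- rewrite /f1; under eq_integral do rewrite EFinM.
  rewrite ge0_integralZl_EFin// integral_indic//.
  by rewrite EFinM lee_wpmul2l ?lee_fin// setIC.
- rewrite ge0_integral_sum//.
  apply: (@le_trans _ _ (\sum_(x <- s) (C / (h * n%:R) * K)%:E)%E).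
    by apply: lee_sum => x _; apply: inv_le; rewrite divr_ge0// ltW.
  rewrite sumEFin lee_fin big_const_seq count_predT iter_addr_0 -[leLHS]mulr_natl.
  apply: (@le_trans _ _ (n%:R * (C / (h * n%:R) * K))).
    by rewrite ler_wpM2r ?ler_nat// mulr_ge0// divr_ge0// ltW.
  rewrite le_eqVlt; apply/orP; left; apply/eqP; field.
  by rewrite !gt_eqF.
- rewrite ge0_integral_sum//.
  apply: (@le_trans _ _ (\sum_(k < n) (abs (cplx (a k)) / (h * n%:R) * K)%:E)%E).
    by apply: lee_sum => k _; apply: inv_le; rewrite divr_ge0 ?abs_ge0// ltW.
  rewrite sumEFin lee_fin -!mulr_suml ler_wpM2r// ler_pdivrMr//.
  by rewrite (le_trans aH)// mulrA divfK ?gt_eqF// mulrC.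
Qed.

End LogarithmIntegral.

(** * Limit points of the sequence, and test functions on the plane *)

Section PlaneTopology.
Variable R : realType.

Lemma nbhs_abs_ball (w : R[i]) (r : R) : 0 < r ->
  nbhs (w : R[i]^o) [set v : R[i]^o | abs (w - v) < r].
Proof.
move=> r0; have rC : 0 < r%:C%C :> R[i] by rewrite ltcR.
apply: filterS (nbhsx_ballx (w : R[i]^o) _ rC) => v.
by rewrite -ball_normE /= normr_abs ltcR.
Qed.

Lemma nbhs_abs_ballP (w : R[i]) (U : set R[i]^o) : nbhs (w : R[i]^o) U ->
  exists2 r : R, 0 < r & forall v, abs (w - v) < r -> U v.
Proof.
move=> /nbhs_ballP[e /= e0 eU]; exists (re e).
  by move: e0; rewrite ltcE => /andP[].
move=> v wv; apply: eU; rewrite -ball_normE /= normr_abs.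
move: e0; rewrite !ltcE /= => /andP[/eqP -> _].
by rewrite eqxx.
Qed.

Lemma infinite_cluster (z : nat -> R[i]) (K : set R[i]^o) :
  compact K -> infinite_set [set k | K (z k)] ->
  exists2 zeta : R[i], K zeta & seq_limit_point z zeta.
Proof.
move=> cK Kinf.
(* [F] consists of the sets that miss only finitely many of the terms in [K]; a cluster point of [F]
   is a limit point of the sequence. *)
pose F := [set A : set R[i]^o | finite_set [set k | K (z k) /\ ~ A (z k)]].
have FF : Filter F.
  split.
  - rewrite /F /= (_ : [set k | _] = set0) ?finite_set0//.
    by apply/seteqP; split => k // [].
  - move=> A B FA FB; apply: (@sub_finite_set _ _
      ([set k | K (z k) /\ ~ A (z k)] `|` [set k | K (z k) /\ ~ B (z k)])).
      move=> k [Kk ABk]; have [Ak|Ak] := pselect (A (z k)); last by left.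
      by right; split => // Bk; apply: ABk.
    by rewrite finite_setU; split.
  - move=> A B AB FA; apply: sub_finite_set FA => k [Kk Bk].
    by split => // /AB.
have PF : ProperFilter F.
  split=> //; rewrite /F /= => h; apply: Kinf; apply: sub_finite_set h => k Kk.
  by split.
have FK : F K.
  rewrite /F /= (_ : [set k | _] = set0) ?finite_set0//.
  by apply/seteqP; split => k // [].
have [zeta [Kzeta clz]] := cK F PF FK; exists zeta => // U Uz Ufin.
have [|v [nUv Uv]] := clz (~` U) U _ Uz; last exact: nUv.
by rewrite /F /=; apply: sub_finite_set Ufin => k [_ /contrapT].
Qed.

(** Brings the hypothesis on compact sets into the form used by [anticoncentration]: a limit point
    [zeta] in [K] differs from [w] because the distance is positive, and [beta] is 1 / (w -
    zeta). *)
Lemma inverse_clusters (z : nat -> R[i]) (w : R[i]) (K : set R[i]^o) :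
  compact K -> 0 < dist w K -> infinite_set [set k | K (z k)] ->
  exists2 beta : R[i], beta != 0 &
    forall tau, 0 < tau -> infinite_set [set k | abs ((w - z k)^-1 - beta) < tau].
Proof.
move=> cK dK Kinf; have [zeta Kz lz] := infinite_cluster cK Kinf.
have m0 : 0 < abs (w - zeta).
  apply: (lt_le_trans dK); apply: ge_inf; last by exists zeta.
  by exists 0 => _ [v _ <-]; exact: abs_ge0.
have wz0 : w - zeta != 0 by rewrite -abs_gt0.
exists (w - zeta)^-1; first by rewrite invr_eq0.
move=> tau tau0; set m := abs (w - zeta) in m0.
(* The first bound forces |w - z_k| > m / 2; the inverses then differ by |zeta - z_k| / (|w - z_k|
   m), which the second makes less than [tau]. *)
pose r := Num.min (m / 2) (tau * (m / 2 * m)).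
have r0 : 0 < r by rewrite lt_min divr_gt0//= !mulr_gt0// invr_gt0.
apply: sub_infinite_set (lz _ (nbhs_abs_ball zeta r0)) => k /= zr.
have zm : abs (zeta - z k) < m / 2.
  by apply: (lt_le_trans zr); rewrite ge_min lexx.
have zt : abs (zeta - z k) < tau * (m / 2 * m).
  by apply: (lt_le_trans zr); rewrite ge_min lexx orbT.
have wk : m / 2 < abs (w - z k).
  have : m <= abs (w - z k) + abs (zeta - z k).
    rewrite /m (_ : w - zeta = (w - z k) - (zeta - z k)); last by ring.
    by rewrite (le_trans (absD _ _))// absN.
  lra.
have wk0 : w - z k != 0 by rewrite -abs_gt0 (le_lt_trans _ wk)// divr_ge0// ltW.
rewrite (_ : _ - _ = - ((zeta - z k) / ((w - z k) * (w - zeta)))); last first.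
  by field; rewrite wk0 wz0.
rewrite absN absM absV absM ltr_pdivrMr; last first.
  by rewrite mulr_gt0// (lt_trans _ wk)// divr_gt0.
apply: (lt_le_trans zt); rewrite ler_pM2l// ler_pM2r//.
exact: ltW.
Qed.

(** Some disc about [w] contains [z k] for finitely many [k] only. These have a positive minimal
    distance from [v], and all other terms are far from the middle of the disc. *)
Lemma not_limit_point_away (z : nat -> R[i]) (w : R[i]) : ~ seq_limit_point z w ->
  exists2 r : R, 0 < r & forall v, abs (w - v) < r -> (forall k, v != z k) ->
    exists2 d0 : R, 0 < d0 & forall k, d0 <= abs (v - z k).
Proof.
move=> /existsNP[U /not_implyP[/nbhs_abs_ballP[r r0 rU] /contrapT Ufin]].
exists (r / 2) => [|v wv vz]; first by rewrite divr_gt0.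
have /finite_seqP[s sE] := Ufin.
have [d0 d00 hd0] : exists2 d0 : R, 0 < d0 & forall k, k \in s -> d0 <= abs (v - z k).
  elim: (s) => [|k s' [d0 d00 ih]]; first by exists 1.
  exists (Num.min d0 (abs (v - z k))).
    by rewrite lt_min d00 /= abs_gt0 subr_eq0.
  move=> j; rewrite inE => /predU1P[->|/ih h]; rewrite ge_min ?lexx ?orbT//.
  by rewrite h.
exists (Num.min d0 (r / 2)) => [|k]; first by rewrite lt_min d00 divr_gt0.
rewrite ge_min; have [ks|ks] := boolP (k \in s); first by rewrite hd0.
have : ~ U (z k).
  by move=> Uk; move/negP: ks; apply; have : [set k | U (z k)] k by []; rewrite sE.
move=> nU; have : r <= abs (w - z k) by rewrite leNgt; apply/negP => /rU.
rewrite (_ : w - z k = (w - v) + (v - z k)); last by ring.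
move=> /le_trans/(_ (absD _ _)) h; apply/orP; right; lra.
Qed.

(** The squares with rational data inside [U] are countably many and cover it. *)
Lemma open_measurable_plane (U : set (R * R)) : open U -> measurable U.
Proof.
move=> oU.
pose box (q : rat * rat * nat) : set (R * R) :=
  sqbox (cplx (ratr q.1.1, ratr q.1.2)) q.2.+1%:R^-1.
pose F i : set (R * R) := if unpickle i is Some q then
  (if `[< box q `<=` U >] then box q else set0) else set0.
have -> : U = \bigcup_i F i.
  apply/seteqP; split => [p Up|p [i _]]; last first.
    rewrite /F; case: unpickle => // q; case: asboolP => // h; exact: h.
  have /nbhs_ballP[e /= e0 eU] : nbhs p U by exact: open_nbhs_nbhs.
  have [n n0] : exists n : nat, n.+1%:R^-1 < e / 3.
    have /ltr_add_invr[n] : 0 < e / 3 by rewrite divr_gt0.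
    by rewrite add0r => ?; exists n.
  have i0 : 0 < n.+1%:R^-1 :> R by rewrite invr_gt0.
  have [q1 hq1] := exists_rat_near p.1 i0.
  have [q2 hq2] := exists_rat_near p.2 i0.
  have sub : box ((q1, q2), n) `<=` U.
    move=> y [/= h1 h2]; apply: eU; split; rewrite /ball /=.
      have -> : p.1 - y.1 = (p.1 - ratr q1) - (y.1 - ratr q1) by ring.
      rewrite (le_lt_trans (ler_normB _ _))//.
      by move: n0 hq1 h1; set i := n.+1%:R^-1 => n0 hq1 h1; lra.
    have -> : p.2 - y.2 = (p.2 - ratr q2) - (y.2 - ratr q2) by ring.
    rewrite (le_lt_trans (ler_normB _ _))//.
    by move: n0 hq2 h2; set i := n.+1%:R^-1 => n0 hq2 h2; lra.
  exists (pickle ((q1, q2), n)); first exact: I.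
  rewrite /F pickleK; case: asboolP => // _.
  by split => /=; exact: ltW.
apply: bigcupT_measurable => i; rewrite /F; case: unpickle => [q|//].
by case: asboolP => // _; exact: measurable_sqbox.
Qed.

Lemma continuous_measurable_plane (g : R * R -> R) :
  continuous g -> measurable_fun setT g.
Proof.
move=> cg; apply: (measurability _ (RGenOpens.measurableE R)).
move=> _ [_ [a [b ->] <-]]; rewrite setTI; apply: open_measurable_plane.
by move/continuousP: cg; apply; exact: interval_open.
Qed.

Lemma laplacian_continuous (f : R * R -> R) : smooth f -> continuous (laplacian f).
Proof.
move=> sf p; apply: cvgD; first exact: (sf [:: false; false]).1.
exact: (sf [:: true; true]).1.
Qed.

Lemma laplacian_support (f : R * R -> R) (p : R * R) :
  laplacian f p != 0 -> closure [set q | f q != 0] p.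
Proof.
apply: contra_neqP => pS.
have [e e0 he] : exists2 e : R, 0 < e & ball p e `<=` [set q | f q = 0].
  have : nbhs p (~` closure [set q | f q != 0]).
    by apply: open_nbhs_nbhs; split => //; exact/closed_openC/closed_closure.
  move=> /nbhs_ballP[e /= e0 h]; exists e => // q /h hq.
  apply: contrapT => /eqP fq; apply: hq; exact: subset_closure.
have zero_near (g : R * R -> R) b : (\forall q \near p, g q = 0) ->
    \forall q \near p, partial b g q = 0.
  move=> /nbhs_interior gp; apply: filterS gp => q gq.
  have : \near q, g q = cst 0 q by exact: gq.
  by rewrite /partial => /near_eq_derive ->; rewrite derive_cst.
have f0 : \forall q \near p, f q = 0 by apply/nbhs_ballP; exists e.
rewrite /laplacian.
have := nbhs_singleton (zero_near _ false (zero_near _ false f0)) => ->.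
have := nbhs_singleton (zero_near _ true (zero_near _ true f0)) => ->.
by rewrite addr0.
Qed.

Lemma laplacian_bounded (f : R * R -> R) : test_function f ->
  exists r B : R, [/\ 0 <= r, 0 <= B, forall p, `|laplacian f p| <= B &
    forall p, laplacian f p != 0 -> sqbox 0 r p].
Proof.
move=> [sf cf]; set S := closure _ in cf.
have [r [_ hr]] := compact_bounded cf.
have cL : compact (laplacian f @` S).
  apply: continuous_compact => //; apply: continuous_subspaceT.
  exact: laplacian_continuous.
have [B [_ hB]] := compact_bounded (cL : compact (laplacian f @` S : set R^o)).
pose r' := Num.max r 0 + 1; pose B' := Num.max B 0 + 1.
have r'r : r < r' by rewrite /r' ltr_pwDr// le_max lexx.
have B'B : B < B' by rewrite /B' ltr_pwDr// le_max lexx.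
have r'0 : 0 <= r' by rewrite addr_ge0// le_max lexx orbT.
have B'0 : 0 <= B' by rewrite addr_ge0// le_max lexx orbT.
exists r', B'; split => // p.
  have [->|/laplacian_support Sp] := eqVneq (laplacian f p) 0; first by rewrite normr0.
  by apply: (hB _ B'B); exists p.
move=> /laplacian_support Sp; have /= := hr _ r'r _ Sp.
rewrite prod_normE ge_max => /andP[h1 h2].
by split; rewrite subr0.
Qed.

End PlaneTopology.

(** * Estimates by the inequality of Markov and by Tonelli's theorem *)

Section ProbabilityBounds.
Variable R : realType.

Lemma cvge0_le (u : nat -> \bar R) : (forall n, 0 <= u n)%E ->
  (forall theta : R, 0 < theta -> \forall n \near \oo, (u n <= theta%:E)%E) ->
  u n @[n --> \oo] --> 0%E.
Proof.
move=> u0 hu; apply/fine_cvgP; split.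
  apply: filterS (hu 1 ltr01) => n un.
  by rewrite ge0_fin_numE// (le_lt_trans un)// ltry.
apply/cvgrPdist_le => e e0; apply: filterS (hu e e0) => n /=.
have := u0 n; case: (u n) => [x| |] //= x0 xe.
by rewrite sub0r normrN ger0_norm.
Qed.

Lemma cvge0_near (u : nat -> \bar R) (theta : R) : u n @[n --> \oo] --> 0%E ->
  0 < theta -> \forall n \near \oo, (u n <= theta%:E)%E.
Proof.
move=> /fine_cvgP[ufin /cvgrPdist_le uc] theta0.
apply: filterS2 ufin (uc _ theta0) => n /= uf; rewrite sub0r normrN => h.
by rewrite -(fineK uf) lee_fin (le_trans (ler_norm _)).
Qed.

Lemma markov_ge0 (d : measure_display) (T : measurableType d)
    (mu : {measure set T -> \bar R}) (f : T -> \bar R) (c : R) :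
  measurable_fun setT f -> (forall t, 0 <= f t)%E -> 0 < c ->
  (c%:E * mu [set t | c%:E <= f t] <= \int[mu]_t f t)%E.
Proof.
move=> mf f0 c0.
have mS : measurable [set t | (c%:E <= f t)%E].
  by rewrite -[X in measurable X]setTI; exact: emeasurable_fun_c_infty.
have mind : measurable_fun setT (fun t => (\1_[set t | (c%:E <= f t)%E] t)%:E : \bar R).
  by apply/measurable_EFinP; exact: measurable_indic.
apply: (@le_trans _ _ (\int[mu]_t (c%:E * (\1_[set t | (c%:E <= f t)%E] t)%:E))%E).
  by rewrite ge0_integralZl_EFin ?(ltW c0)// integral_indic// setIT.
apply: ge0_le_integral => //.
- by move=> t _; rewrite mule_ge0// lee_fin// ltW.
- exact: measurable_funeM.
- move=> t _; rewrite indicE; have [tS|_] := boolP (t \in _).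
    by rewrite mule1; move: tS; rewrite inE.
  by rewrite mule0.
Qed.

Lemma expRN_natr_le (eps delta : R) : 0 < eps -> 0 < delta ->
  \forall n \near \oo, expR (- (eps * n%:R)) <= delta.
Proof.
move=> eps0 delta0.
apply: filterS (nbhs_infty_ger (- ln delta / eps)) => n hn.
rewrite -[leRHS](lnK (_ : delta \is Num.pos))// ler_expR.
by move: hn; rewrite ler_pdivrMr// mulrC lerNl.
Qed.

(** For [n = 0], and where L_n vanishes, [logpot] is 0 by convention and hence not below [- eps];
    otherwise exponentiate. *)
Lemma logpot_lt (c z : nat -> R[i]) (n : nat) (p : R * R) (eps : R) : 0 < eps ->
  logpot c z n p < - eps -> abs (L c z n (cplx p)) < expR (- (eps * n%:R)).
Proof.
rewrite /logpot => eps0; case: n => [|n].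
  by rewrite invr0 mul0r ltrNr oppr0 => /lt_trans/(_ eps0); rewrite ltxx.
have n0 : 0 < n.+1%:R :> R by rewrite ltr0n.
rewrite mulrC ltr_pdivrMr// mulNr => h.
have Lp : 0 < abs (L c z n.+1 (cplx p)).
  rewrite lt_neqAle abs_ge0 andbT eq_sym; apply/eqP => L0.
  by move: h; rewrite L0 ln0// oppr_gt0 ltNge mulr_ge0 ?ltW.
by rewrite -[ltLHS]lnK ?posrE// ltr_expR.
Qed.

Let plane := (measurableTypeR R * measurableTypeR R)%type.
Context (d : measure_display) (T : measurableType d).
Context (P : probability T R) (a : nat -> {RV P >-> (R * R)%type}).
Variable z : nat -> R[i].

Local Notation v n p t := (logpot (fun k => cplx (a k t)) z n p).

Let measurable_v n :
  measurable_fun setT (fun q : plane * T => v n q.1 q.2).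
Proof.
apply: (@measurable_logpot _ _ (plane * T)%type (fun k q => a k q.2)) => //.
by move=> k; exact: measurableT_comp.
Qed.

Let pairing_integrand n (f : R * R -> R) (q : plane * T) : \bar R :=
  (v n q.1 q.2 * laplacian f q.1)%:E.

Let measurable_pairing_integrand n f : smooth f ->
  measurable_fun setT (pairing_integrand n f).
Proof.
move=> sf; apply/measurable_EFinP; apply: measurable_funM => //.
have mf : measurable_fun setT (laplacian f : plane -> R).
  by apply: continuous_measurable_plane; exact: laplacian_continuous.
exact: (measurableT_comp mf (@measurable_fst _ _ _ _)).
Qed.

(** Tonelli is applied to the positive and to the negative part, so that no integrability has to be
    checked. *)
Lemma measurable_log_potential_pairing n (f : R * R -> R) : smooth f ->
  measurable_fun setT
    (fun t => log_potential_pairing (fun k => cplx (a k t)) z n f).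
Proof.
move=> sf; have mG := measurable_pairing_integrand n sf.
pose g t := (\int[area R]_p pairing_integrand n f (p, t))%E.
suff mg : measurable_fun setT g.
  exact: (measurableT_comp (fine_measurable measurableT) mg).
have mp := measurable_fun_fubini_tonelli_G (m1 := area R) _
  (measurable_funepos mG) (funepos_ge0 _).
have mm := measurable_fun_fubini_tonelli_G (m1 := area R) _
  (measurable_funeneg mG) (funeneg_ge0 _).
have := emeasurable_funB mp mm.
apply: eq_measurable_fun => t _; rewrite /= /g [RHS]integralE; congr (_ - _)%E;
  by apply: eq_integral => p _; rewrite ?funeposE ?funenegE.
Qed.

(** * The set where the potential is below [- eps] *)

Section LowSet.
Variables (r eps : R).
Let D : set plane := sqbox 0 r.

Let low n : set (plane * T) := [set q | D q.1 /\ v n q.1 q.2 < - eps].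

Lemma measurable_low n : measurable (low n).
Proof.
have -> : low n = (D `*` setT) `&` [set q | v n q.1 q.2 < - eps].
  by apply/seteqP; split => q /= => [[]|[[]]].
apply: measurableI.
  by apply: measurableX => //; exact: measurable_sqbox.
have := measurable_fun_ltr (measurable_v n) (measurable_cst (- eps)).
by move=> /(_ measurableT [set true] I); rewrite setTI.
Qed.

Lemma ysection_low n t : ysection (low n) t = D `&` [set p | v n p t < - eps].
Proof. by apply/seteqP; split => p; rewrite /ysection /= inE. Qed.

Lemma measurable_low_area n :
  measurable_fun setT (fun t => area R (D `&` [set p | v n p t < - eps])).
Proof.
have := measurable_fun_ysection (area R) (measurable_low n).
by apply: eq_measurable_fun => t _ /=; rewrite ysection_low.
Qed.

(** Tonelli for the indicator of [low n], whose sections are sets in the plane in one direction and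
    events in the other. *)
Lemma integral_low_area n :
  (\int[P]_t area R (D `&` [set p | (v n p t < - eps)%R]) =
   \int[area R]_(p in D) P (xsection (low n) p))%E.
Proof.
have mlow := measurable_low n.
pose f (q : plane * T) : \bar R := (\1_(low n) q)%:E.
have mf : measurable_fun setT f by apply/measurable_EFinP; exact: measurable_indic.
have f0 q : (0 <= f q)%E by rewrite lee_fin.
transitivity (\int[P]_t \int[area R]_p f (p, t))%E.
  apply: eq_integral => t _; rewrite -ysection_low -[X in area R X]setIT.
  rewrite -integral_indic//; last exact: measurable_ysection.
  by apply: eq_integral => p _; rewrite /f !indicE mem_ysection.
rewrite -(fubini_tonelli (m1 := area R) (m2 := P) _ mf f0) [RHS]integral_mkcond.
apply: eq_integral => p _; rewrite patchE; case: ifPn => [_|/negP pD].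
  rewrite -[X in P X]setIT -integral_indic//; last exact: measurable_xsection.
  by apply: eq_integral => t _; rewrite /f !indicE mem_xsection.
rewrite integral0_eq// => t _; rewrite /f indicE; case: (boolP (_ \in _)) => //.
by rewrite inE => -[/= Dp _]; case: pD; rewrite inE.
Qed.

Hypothesis a_indep : mutually_independent a.
Hypothesis a_ident : identically_distributed a.
Hypothesis a_nondegenerate : ~ degenerate (a 0%N).
Hypothesis r_ge0 : 0 <= r.
Hypothesis eps_gt0 : 0 < eps.
Hypothesis z_acc : {ae area R, forall p : plane, exists2 beta : R[i], beta != 0 &
  forall tau, 0 < tau -> infinite_set [set k | abs ((cplx p - z k)^-1 - beta) < tau]}.

(** On this event |L_n(p)| < exp(- eps n), which is eventually at most the [delta] of
    [anticoncentration]. *)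
Lemma P_low_near (p : plane) (theta : R) : 0 < theta ->
  (exists2 beta : R[i], beta != 0 & forall tau, 0 < tau ->
    infinite_set [set k | abs ((cplx p - z k)^-1 - beta) < tau]) ->
  \forall n \near \oo, (P (xsection (low n) p) <= theta%:E)%E.
Proof.
move=> theta0 [beta beta0 hbeta].
have [delta delta0 hdelta] :=
  anticoncentration a_indep a_ident a_nondegenerate beta0 hbeta.
apply: filterS2 (hdelta _ theta0) (expRN_natr_le eps_gt0 delta0) => n h1 h2.
apply: le_trans h1; apply: le_measure; rewrite ?inE.
- exact: measurable_xsection (measurable_low n).
- have mL : cmeasurable (fun t => L (fun k => cplx (a k t)) z n (cplx p)).
    by apply: measurable_L => //; exact: measurable_cst.
  have := measurable_fun_ltr (measurable_abs mL) (measurable_cst delta).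
  by move=> /(_ measurableT [set true] I); rewrite setTI.
- move=> t; rewrite /xsection /= inE => -[/= _ /(logpot_lt eps_gt0) h].
  exact: lt_le_trans h h2.
Qed.

(** The expected area is the integral over [D] of probabilities that tend to 0 almost everywhere and
    are at most 1. As [D] has finite area, dominated convergence makes it at most [eta * theta], and
    Markov's inequality concludes. *)
Lemma low_area_small (eta theta : R) : 0 < eta -> 0 < theta ->
  \forall n \near \oo,
    (P [set t | eta%:E <= area R (D `&` [set p | (v n p t < - eps)%R])] <=
     theta%:E)%E.
Proof.
move=> eta0 theta0.
have mD : measurable D by exact: measurable_sqbox.
have mlow n : measurable_fun D (fun p : plane => P (xsection (low n) p)).
  apply: measurable_funTS.
  exact: (measurable_fun_xsection P (measurable_low n)).
have xlow1 n p : (`|P (xsection (low n) p)| <= 1)%E.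
  rewrite gee0_abs// probability_le1//.
  exact: measurable_xsection (measurable_low n).
have i1 : (area R).-integrable D (cst 1%E).
  apply/integrableP; split => //.
  rewrite (_ : (fun x => _) = cst 1%E); last by apply/funext => x; exact: gee0_abs.
  by rewrite integral_cst// [X in (_ * X)%E]area_sqbox// mul1e ltry.
have [||_ _] := @dominated_convergence _ _ _ (area R) D mD
  (fun n p => P (xsection (low n) p)) (cst 0%E) (cst 1%E) mlow
  (measurable_cst _) _ i1 _.
- apply: filterS z_acc => p pacc _.
  by apply: cvge0_le => // theta' theta'0; exact: P_low_near.
- by apply: aeW => p n _; exact: xlow1.
rewrite integral0 => /cvge0_near/(_ (mulr_gt0 eta0 theta0)).
apply: filterS => n hn; rewrite -(@lee_pmul2l _ eta%:E) ?lte_fin//.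
rewrite -EFinM; apply: le_trans hn; rewrite -integral_low_area.
by apply: markov_ge0 => //; exact: measurable_low_area.
Qed.

End LowSet.

(** Markov's inequality; by identical distribution the expected sum is [n] times the first absolute
    moment. *)
Lemma sum_abs_small (theta H : R) (n : nat) : identically_distributed a ->
  (0 < n)%N -> 0 < H ->
  ('E_P[fun t => abs (cplx (a 0%N t))] <= (theta * H)%:E)%E ->
  (P [set t | (n%:R * H)%:E <= (\sum_(k < n) abs (cplx (a k t)))%:E] <= theta%:E)%E.
Proof.
move=> a_ident n0 H0; rewrite unlock => EaH.
have mabs k : measurable_fun setT (fun t => (abs (cplx (a k t)))%:E).
  apply/measurable_EFinP; apply: measurable_abs.
  exact: (cmeasurable_cplx (measurable_funPT (a k))).
have N0 : 0 < n%:R * H by rewrite mulr_gt0// ltr0n.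
rewrite -(@lee_pmul2l _ (n%:R * H)%:E) ?lte_fin//.
have mS : measurable_fun setT (fun t => (\sum_(k < n) abs (cplx (a k t)))%:E).
  by under eq_fun do rewrite -sumEFin; apply: emeasurable_sum => k.
have S0 t : (0 <= (\sum_(k < n) abs (cplx (a k t)))%:E)%E.
  by rewrite lee_fin sumr_ge0// => k _; exact: abs_ge0.
have := markov_ge0 P mS S0 N0; move/le_trans; apply.
under eq_integral do rewrite -sumEFin.
rewrite ge0_integral_sum//; last by move=> k t _; rewrite lee_fin abs_ge0.
have mC : measurable_fun setT (fun x : R * R => (abs (cplx x))%:E).
  apply/measurable_EFinP; apply: measurable_abs.
  exact: (cmeasurable_cplx (@measurable_id _ _ _)).
have C0 (x : R * R) : (0 <= (abs (cplx x))%:E)%E by rewrite lee_fin abs_ge0.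
have Eak k : (\int[P]_t (abs (cplx (a k t)))%:E =
    \int[P]_t (abs (cplx (a 0%N t)))%:E)%E.
  rewrite -[LHS](ge0_integral_distribution (a k) mC C0).
  rewrite -[RHS](ge0_integral_distribution (a 0%N) mC C0).
  by apply: eq_measure_integral => A mA _; exact: a_ident.
apply: (@le_trans _ _ (\sum_(k < n) (theta * H)%:E)%E).
  by apply: lee_sum => k _; rewrite Eak.
rewrite sumEFin sumr_const card_ord -EFinM lee_fin -[leLHS]mulr_natl.
by rewrite le_eqVlt; apply/orP; left; apply/eqP; ring.
Qed.

End ProbabilityBounds.

(** * Pairing with a test function, and the conclusion *)

Lemma normr_pairing_le (R : realType) (a : nat -> R * R) (z : nat -> R[i])
    (n : nat) (f : R * R -> R) (r B M : R) : smooth f -> 0 <= B ->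
  (forall p, `|laplacian f p| <= B) ->
  (forall p, laplacian f p != 0 -> sqbox 0 r p) ->
  (\int[area R]_(p in sqbox 0%R r) `|logpot (fun k => cplx (a k)) z n p|%:E <=
    M%:E)%E ->
  `|log_potential_pairing (fun k => cplx (a k)) z n f| <= B * M.
Proof.
move=> sf B0 fB fr hM; set v := logpot _ z n in hM.
pose plane := (measurableTypeR R * measurableTypeR R)%type.
have mv : measurable_fun setT (v : plane -> R).
  by apply: (@measurable_logpot _ _ plane (fun k => cst (a k)) z id).
have mf : measurable_fun setT (laplacian f : plane -> R).
  by apply: continuous_measurable_plane; exact: laplacian_continuous.
have mD : measurable (sqbox 0 r : set plane) by exact: measurable_sqbox.
have mvf : measurable_fun setT (fun p : plane => (v p * laplacian f p)%:E).
  by apply/measurable_EFinP; exact: measurable_funM.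
have mabs : measurable_fun (sqbox 0 r) (fun p : plane => `|v p|%:E).
  apply: measurable_funTS; apply/measurable_EFinP; exact: measurableT_comp.
suff : (`|\int[area R]_p (v p * laplacian f p)%:E| <= (B * M)%:E)%E.
  rewrite -[log_potential_pairing _ _ _ _]/(fine (\int[area R]_p (v p * laplacian f p)%:E)%E).
  by case: (\int[area R]_p _)%E => [x| |] //=; rewrite normr0 leNgt ltNge.
apply: (le_trans (le_abse_integral _ _ _)) => //.
apply: (@le_trans _ _ (\int[area R]_(p in sqbox 0%R r) (B%:E * `|v p|%:E))%E).
  rewrite [leRHS]integral_mkcond; apply: ge0_le_integral => //.
  - exact: measurableT_comp.
  - apply/(measurable_restrictT _ mD); exact: measurable_funeM.
  - move=> p _; rewrite /= patchE; case: ifPn => [_|/negP pD].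
      by rewrite -EFinM lee_fin normrM mulrC ler_wpM2r.
    have [->|/fr Dp] := eqVneq (laplacian f p) 0; first by rewrite mulr0 normr0.
    by case: pD; rewrite inE.
rewrite ge0_integralZl_EFin//.
by rewrite EFinM lee_wpmul2l// lee_fin.
Qed.

Theorem theorem1p16 (R : realType) (d : measure_display) (T : measurableType d)
    (P : probability T R) (a : nat -> {RV P >-> (R * R)%type})
    (z : nat -> R[i])
    (a_indep : mutually_independent a)
    (a_ident : identically_distributed a)
    (a_nondegenerate : ~ degenerate (a 0%N))
    (a_integrable : ('E_P[fun t => abs (cplx (a 0%N t))] < +oo)%E)
    (z_recurrent : {ae lebesgueC R, forall p, exists K : set R[i]^o,
        [/\ compact K, 0 < dist (cplx p) K & infinite_set [set k | K (z k)]]})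
    (z_limit_points : exists w : R[i], ~ seq_limit_point z w) :
  forall f : R * R -> R, test_function f ->
    cvg_in_probability P
      (fun n t => log_potential_pairing (fun k => cplx (a k t)) z n f) 0.
Proof.
move=> f tf e e0; have [sf _] := tf.
pose plane := (measurableTypeR R * measurableTypeR R)%type.
have [r [B [r0 B0 fB fr]]] := laplacian_bounded tf.
have [K [K0 hK]] : exists K : R, 0 <= K /\ forall zeta : R[i],
    (\int[area R]_(p in sqbox 0%R r) (abs (cplx p - zeta))^-1%:E <= K%:E)%E.
  have [K hK] := integral_inv_dist r0; exists (Num.max K 0).
  split=> [|zeta]; first by rewrite le_max lexx orbT.
  by apply: le_trans (hK zeta) _; rewrite lee_fin le_max lexx.
pose acc p := exists2 beta : R[i], beta != 0 & forall tau, 0 < tau ->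
  infinite_set [set k | abs ((cplx p - z k)^-1 - beta) < tau].
have z_acc : {ae area R, forall p : plane, acc p}.
  case: z_recurrent => N [mN N0 hN]; exists N; split => // p nacc.
  apply: hN => -[Kp [cK dK iK]]; apply: nacc.
  exact: inverse_clusters cK dK iK.
have [w0 /not_limit_point_away[rho rho0 hrho]] := z_limit_points.
(* A square has positive area and so is not covered by two null sets. Half-side [rho / 4] keeps [p0]
   within [rho / 2] of [w0]. *)
have [p0 boxp0 [[beta beta0 hbeta] p0z]] : exists2 p, sqbox w0 (rho / 4) p &
    acc p /\ forall k, cplx p != z k.
  have [N1 [mN1 N10 hN1]] := z_acc.
  have [N2 [mN2 N20 hN2]] := ae_off_sequence z.
  apply: contrapT => hbox.
  have : (area R (sqbox w0 (rho / 4)) <= area R (N1 `|` N2))%E.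
    apply: le_measure; rewrite ?inE//; first exact: measurable_sqbox.
      exact: measurableU.
    move=> p boxp; apply: contrapT => /not_orP[Np1 Np2]; apply: hbox; exists p => //.
    split; first by apply: contrapT => h; apply: Np1; exact: hN1.
    by apply: contrapT => h; apply: Np2; exact: hN2.
  have N_le0 : (area R (N1 `|` N2) <= 0)%E.
    have E1 : area R N1 = 0%E by exact: N10.
    have E2 : area R N2 = 0%E by exact: N20.
    have := measureU2 (area R) mN1 mN2.
    by rewrite [X in (_ <= X + _)%E]E1 [X in (_ <= _ + X)%E]E2 adde0.
  move=> /le_trans/(_ N_le0).
  rewrite area_sqbox ?divr_ge0 ?(ltW rho0)// lee_fin leNgt => /negP.
  by apply; rewrite exprn_gt0// mulrn_wgt0// divr_gt0.
pose w := cplx p0.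
have [|d0 d00 hd0] := hrho w _ p0z.
  by rewrite absB (le_lt_trans (sqbox_abs boxp0))// mulr2n; lra.
have [delta delta0 hdelta] :=
  anticoncentration a_indep a_ident a_nondegenerate beta0 hbeta.
pose C := r *+ 2 + abs w.
have C0 : 0 <= C by rewrite addr_ge0 ?abs_ge0// mulrn_wge0.
have DC (p : R * R) : sqbox 0 r p -> abs (cplx p - w) <= C.
  move=> /sqbox_abs; rewrite subr0 => h.
  by rewrite (le_trans (absD _ _))// absN lerD2r.
apply: cvge0_le => [n|theta theta0]; first exact: measure_ge0.
have Ea0 : (0 <= 'E_P[fun t => abs (cplx (a 0%N t))])%E.
  by apply: expectation_ge0 => t; exact: abs_ge0.
pose Ea := fine ('E_P[fun t => abs (cplx (a 0%N t))])%E.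
have EaE : ('E_P[fun t => abs (cplx (a 0%N t))] = Ea%:E)%E.
  by rewrite fineK// ge0_fin_numE.
have Ea_ge0 : 0 <= Ea by rewrite fine_ge0.
have theta3 : 0 < theta / 3 by rewrite divr_gt0.
(* The sum of the |a_k| reaches [n H] with probability at most [theta / 3]; the added 1 makes [H]
   positive. *)
pose H := (Ea + 1) / (theta / 3).
have H0 : 0 < H by rewrite divr_gt0// ltr_wpDl.
have EaH : ('E_P[fun t => abs (cplx (a 0%N t))] <= (theta / 3 * H)%:E)%E.
  by rewrite EaE lee_fin /H mulrC divfK ?gt_eqF// lerDl.
(* A bound [E] for the integral of |u_n| bounds the pairing by [B * E <= e]. *)
pose E := e / (B + 1).
have B1 : 0 < B + 1 by rewrite ltr_wpDl.
have E0 : 0 < E by rewrite divr_gt0.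
(* [h] makes the share of zeros and poles at most [E / 4]. It is fixed before [eta], which has to
   outweigh the [ln h] inside [kappa]. *)
pose h := 1 + 4 * ((C + H) * K) / E.
have CHK0 : 0 <= (C + H) * K by rewrite mulr_ge0// addr_ge0// ltW.
have h1 : 1 <= h by rewrite lerDl divr_ge0 ?(ltW E0)// mulr_ge0.
have h0 : 0 < h by exact: lt_le_trans h1.
have lnh0 : 0 <= ln h by exact: ln_ge0.
pose kappa := 2 + C / d0 + ln h.
have kappa0 : 0 <= kappa by rewrite !addr_ge0// divr_ge0// ltW.
pose A := (r *+ 2) ^+ 2.
have A0 : 0 <= A by exact: sqr_ge0.
pose eps := E / (4 * (A + 1)).
have eps0 : 0 < eps by rewrite divr_gt0// mulr_gt0// ltr_wpDl.
pose eta := E / (4 * (kappa + 1)).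
have eta0 : 0 < eta by rewrite divr_gt0// mulr_gt0// ltr_wpDl.
have low := low_area_small (z := z) a_indep a_ident a_nondegenerate r0 eps0 z_acc
  eta0 theta3.
(* Four shares of [E / 4]; the one from [ln h / n] requires [n] to be large. *)
have bound n : (0 < n)%N -> 4 * (ln h * A) / E <= n%:R ->
    (eps + ln h / n%:R) * A + kappa * eta + C / h * K + H / h * K <= E.
  move=> n0 nA; have N0 : 0 < n%:R :> R by rewrite ltr0n.
  have share x : 0 <= x -> E / (4 * (x + 1)) * x <= E / 4.
    move=> x0; have x1 : 0 < x + 1 by rewrite ltr_wpDl.
    rewrite (_ : _ * x = E / 4 * (x / (x + 1))); last by field; rewrite gt_eqF.
    have xle : x / (x + 1) <= 1 by rewrite ler_pdivrMr// mul1r lerDl.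
    by apply: ler_piMr => //; rewrite divr_ge0// ltW.
  have b1 : eps * A <= E / 4 by exact: share.
  have b2 : ln h / n%:R * A <= E / 4.
    rewrite mulrAC ler_pdivrMr//; move: nA; rewrite ler_pdivrMr//.
    by move=> nA; lra.
  have b3 : kappa * eta <= E / 4 by rewrite mulrC; exact: share.
  have b4 : C / h * K + H / h * K <= E / 4.
    rewrite -mulrDl -mulrDl mulrAC ler_pdivrMr// /h mulrDr mulr1.
    rewrite (_ : E / 4 * _ = (C + H) * K); last by field; rewrite gt_eqF.
    by rewrite lerDr divr_ge0// ltW.
  by rewrite mulrDl; lra.
near=> n.
have n0 : (0 < n)%N by near: n; exact: nbhs_infty_gt.
(* Three exceptional events of probability at most [theta / 3] each: large coefficients, small
   |L_n(w)|, and a low set of large area. *)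
pose B1set := [set t | (n%:R * H)%:E <= (\sum_(k < n) abs (cplx (a k t)))%:E]%E.
pose B2set := [set t | abs (L (fun k => cplx (a k t)) z n w) < delta].
pose B3set := [set t | eta%:E <= area R (sqbox 0%R r `&`
  [set p | (logpot (fun k => cplx (a k t)) z n p < - eps)%R])]%E.
have PB1 : (P B1set <= (theta / 3)%:E)%E by exact: sum_abs_small.
have PB2 : (P B2set <= (theta / 3)%:E)%E by rewrite /B2set; near: n; exact: hdelta.
have PB3 : (P B3set <= (theta / 3)%:E)%E by rewrite /B3set; near: n; exact: low.
have mB1 : measurable B1set.
  rewrite -[X in measurable X]setTI; apply: emeasurable_fun_c_infty => //.
  under eq_fun do rewrite -sumEFin.
  apply: emeasurable_sum => k; apply/measurable_EFinP; apply: measurable_abs.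
  exact: (cmeasurable_cplx (measurable_funPT (a k))).
have mB2 : measurable B2set.
  have mL : cmeasurable (fun t => L (fun k => cplx (a k t)) z n w).
    by rewrite /w; apply: measurable_L => //; exact: measurable_cst.
  have := measurable_fun_ltr (measurable_abs mL) (measurable_cst delta).
  by move=> /(_ measurableT [set true] I); rewrite setTI.
have mB3 : measurable B3set.
  rewrite -[X in measurable X]setTI; apply: emeasurable_fun_c_infty => //.
  exact: measurable_low_area.
have mY : measurable [set t |
    e < `|log_potential_pairing (fun k => cplx (a k t)) z n f - 0|].
  under eq_set do rewrite subr0.
  have := measurable_fun_ltr (measurable_cst e)
    (measurableT_comp (@normr_measurable R setT) (measurable_log_potential_pairing a z n sf)).
  by move=> /(_ measurableT [set true] I); rewrite setTI.
(* Off the three events the bounds for a fixed sample apply and keep the pairing at most [e]. *)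
apply: (@le_trans _ _ (P (B1set `|` B2set `|` B3set))).
  apply: le_measure; rewrite ?inE//.
    by apply: measurableU => //; exact: measurableU.
  move=> t /=; rewrite subr0 => eY; apply: contrapT => /not_orP[/not_orP[nB1 nB2] nB3].
  move: eY; apply/negP; rewrite -leNgt.
  have sumH : \sum_(k < n) abs (cplx (a k t)) <= n%:R * H.
    by rewrite leNgt; apply/negP => /ltW hH; apply: nB1; rewrite /B1set /= lee_fin.
  have Lw : expR (- n%:R) <= abs (L (fun k => cplx (a k t)) z n w).
    (* [delta] does not depend on [n], so exp(-n) is eventually below it. *)
    apply: (@le_trans _ _ delta); last by rewrite leNgt; exact/negP.
    by rewrite -[n%:R]mul1r; near: n; exact: expRN_natr_le.
  have Alow : (area R (sqbox 0%R r `&`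
      [set p | (logpot (fun k => cplx (a k t)) z n p < - eps)%R]) <= eta%:E)%E.
    by rewrite leNgt; apply/negP => /ltW; exact: nB3.
  have := integral_logpot_le n0 r0 C0 d00 h1 (ltW eps0) K0 hd0 Lw DC hK sumH Alow.
  move=> /(normr_pairing_le sf B0 fB fr)/le_trans; apply.
  apply: (@le_trans _ _ (B * E)).
    rewrite ler_wpM2l//; apply: bound => //.
    by near: n; exact: nbhs_infty_ger.
  by rewrite /E mulrCA ler_piMr ?(ltW e0)// ler_pdivrMr// mul1r lerDl.
apply: (le_trans (measureU2 _ _ _)) => //; first exact: measurableU.
apply: (@le_trans _ _ ((theta / 3)%:E + (theta / 3)%:E + (theta / 3)%:E)%E).
  apply: leeD => //; apply: (le_trans (measureU2 _ _ _)) => //.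
  exact: leeD.
by rewrite -!EFinD lee_fin; lra.
Unshelve. all: by end_near.
Qed.
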